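(* Let $T>0$ and $w>0$, and let the intertemporal aggregator $f:[0,T]\times\mathbb{R}_+\times\mathbb{R}\to\mathbb{R}$ satisfy the assumptions (a1)–(a3) listed in the context. Then the utility maximization problem $$v(w)=\sup_{C\in\mathcal{A}(w)}U_0^C$$ has a solution, i.e. there is $C^*\in\mathcal{A}(w)$ with $U_0^{C^*}=v(w)$. The solution is unique if the map $C\mapsto Y^C$ is injective.
   Context: Notation: $\mathbb{R}_+=[0,\infty)$, $\mathbb{R}_{++}=(0,\infty)$. $\mathcal{X}$ is the set of nondecreasing, right-continuous functions $C:[0,T]\to\mathbb{R}_+$, with the convention $C_{0-}:=0$; each $C\in\mathcal{X}$ is identified with the finite measure $dC$ on $[0,T]$ of which it is the distribution function (so $C_0>0$ is a point mass at $0$). Integrals with respect to $dC$ are over closed intervals. Price: $\psi:[0,T]\to\mathbb{R}_{++}$ is continuous, and $\mathcal{A}(w)=\{C\in\mathcal{X}:\int_0^T\psi_t\,dC_t\le w\}$ is the budget set. Level of satisfaction: $Y^C_t=\eta_t+\int_0^t\theta_{t,s}\,dC_s$, where $\eta:[0,T]\to\mathbb{R}_+$ and $\theta:[0,T]^2\to\mathbb{R}_+$ are continuous. Recursive utility: for $C\in\mathcal{X}$, $U^C$ is the unique solution of $U_t^C=\int_t^T f(s,Y_s^C,U_s^C)\,ds$, $t\in[0,T]$. Assumptions on $f$ ($f$ is Borel measurable in $s$): (a1) for each $s\in[0,T]$, $f(s,\cdot,\cdot)$ is strictly concave and continuously differentiable, and for all $s\in[0,T]$, $u\in\mathbb{R}$,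 $f(s,\cdot,u)$ is strictly increasing; (a2) there is a constant $K>0$ such that $|f(s,y,u)-f(s,y,u')|\le K|u-u'|$ for all $(s,y)\in[0,T]\times\mathbb{R}_+$ and $u,u'\in\mathbb{R}$; (a3) there are constants $\alpha\in(0,1)$ and $K>0$ such that $|f(s,y,0)|\le K(1+|y|^\alpha)$ for all $s\in[0,T]$, $y\in\mathbb{R}_+$. *)

(* Defs.v *)
From HB Require Import structures.
From mathcomp Require Import all_boot all_order all_algebra.
From mathcomp Require Import all_classical all_reals all_analysis.

Set Implicit Arguments.
Unset Strict Implicit.
Unset Printing Implicit Defensive.

Import Order.TTheory GRing.Theory Num.Theory.
Import numFieldNormedType.Exports.

Local Open Scope classical_set_scope.
Local Open Scope ring_scope.

(* A nondecreasing right-continuous C : [0, T] -> R_+ is encoded by its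
   extension to the real line: 0 to the left of 0 (the convention C_{0-} = 0)
   and C_T to the right of T.  This is the distribution function of the measure
   dC, including the point mass C_0 at 0; its values are nonnegative because it
   is nondecreasing. *)
Definition consumption_plans (R : realType) (T : R) : set (cumulative R R) :=
  [set C | (forall t, t < 0 -> C t = 0) /\ (forall t, T < t -> C t = C T)].

Definition budget_set (R : realType) (T : R) (psi : R -> R) (w : R) :
    set (cumulative R R) :=
  [set C | consumption_plans T C /\
    (\int[lebesgue_stieltjes_measure C]_(t in `[0%R, T]) (psi t)%:E
       <= w%:E)%E].

Definition satisfaction (R : realType) (eta : R -> R) (theta : R -> R -> R)
    (C : cumulative R R) (t : R) : R :=
  eta t + \int[lebesgue_stieltjes_measure C]_(s in `[0, t]) theta t s.

Definition utility_equation (R : realType) (T : R) (f : R -> R -> R -> R)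
    (Y U : R -> R) : Prop :=
  (@lebesgue_measure R).-integrable `[0, T]
    (fun s => (f s (Y s) (U s))%:E) /\
  forall t, t \in `[0, T] ->
    U t = \int[@lebesgue_measure R]_(s in `[t, T]) f s (Y s) (U s).

(* The default value of xget plays no role for an aggregator f in the sense
   below: the Lipschitz and growth conditions make the equation uniquely
   solvable on [0, T]. *)
Definition recursive_utility (R : realType) (T : R) (f : R -> R -> R -> R)
    (eta : R -> R) (theta : R -> R -> R) (C : cumulative R R) : R -> R :=
  xget (fun=> 0) [set U | utility_equation T f (satisfaction eta theta C) U].

Definition value (R : realType) (T : R) (psi : R -> R) (f : R -> R -> R -> R)
    (eta : R -> R) (theta : R -> R -> R) (w : R) : \bar R :=
  ereal_sup [set (recursive_utility T f eta theta C 0)%:E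
            | C in budget_set T psi w].

Definition solution (R : realType) (T : R) (psi : R -> R) (f : R -> R -> R -> R)
    (eta : R -> R) (theta : R -> R -> R) (w : R) (C : cumulative R R) : Prop :=
  budget_set T psi w C /\
  (recursive_utility T f eta theta C 0)%:E = value T psi f eta theta w.

Definition satisfaction_injective (R : realType) (T : R) (eta : R -> R)
    (theta : R -> R -> R) : Prop :=
  forall C C' : cumulative R R,
    consumption_plans T C -> consumption_plans T C' ->
    {in `[0, T], satisfaction eta theta C =1 satisfaction eta theta C'} ->
    {in `[0, T], C =1 C'}.

Definition half_plane (R : realType) : set (R * R) := [set z | 0 <= z.1].

Definition strictly_concave_on (R : realType) (D : set (R * R))
    (g : R -> R -> R) : Prop :=
  forall (z z' : R * R) (a : R), D z -> D z' -> z <> z' -> 0 < a < 1 ->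
    a * g z.1 z.2 + (1 - a) * g z'.1 z'.2 <
    g (a * z.1 + (1 - a) * z'.1) (a * z.2 + (1 - a) * z'.2).

(* The derivative is taken relative to D, hence is one-sided at the boundary
   of the half-plane; g1 and g2 are the partial derivatives. *)
Definition C1_on (R : realType) (D : set (R * R)) (g : R -> R -> R) : Prop :=
  exists g1 g2 : R * R -> R,
    [/\ {within D, continuous g1}, {within D, continuous g2} &
      forall z, D z -> forall e : R, 0 < e ->
        \forall z' \near within D (nbhs z),
          `|g z'.1 z'.2 - g z.1 z.2
            - (g1 z * (z'.1 - z.1) + g2 z * (z'.2 - z.2))| <= e * `|z' - z|].

Record aggregator (R : realType) (T : R) (f : R -> R -> R -> R) : Prop := {
  aggregator_measurable : forall y u, 0 <= y ->
    measurable_fun `[0, T] (fun s => f s y u) ;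
  aggregator_strictly_concave : forall s, s \in `[0, T] ->
    strictly_concave_on (@half_plane R) (f s) ;
  aggregator_C1 : forall s, s \in `[0, T] -> C1_on (@half_plane R) (f s) ;
  aggregator_increasing : forall s u, s \in `[0, T] ->
    {in `[0, +oo[ &, {homo (fun y => f s y u) : y y' / y < y'}} ;
  aggregator_lipschitz : exists2 K : R, 0 < K &
    forall s y u u', s \in `[0, T] -> 0 <= y ->
      `|f s y u - f s y u'| <= K * `|u - u'| ;
  aggregator_growth : exists alpha K : R, [/\ 0 < alpha < 1, 0 < K &
    forall s y, s \in `[0, T] -> 0 <= y ->
      `|f s y 0| <= K * (1 + `|y| `^ alpha)] }.

(* Main.v *)
Require Import Defs.
From HB Require Import structures.
From mathcomp Require Import all_boot all_order all_algebra.
From mathcomp Require Import all_classical all_reals all_analysis.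
From mathcomp Require Import measurable_realfun ring lra.

Import Order.TTheory GRing.Theory Num.Theory.
Import numFieldNormedType.Exports.

Local Open Scope classical_set_scope.
Local Open Scope ring_scope.

(** Existence is the direct method. Since psi is bounded below by a positive
constant, all affordable plans have total mass at most some M, so Helly
selection ([helly_selection]) extracts from a maximizing sequence plans Cn that
converge to a plan C at every continuity point of C, hence almost everywhere,
and also at T. The integral of a continuous function against dCn then converges
to the one against dC ([stieltjes_cvg]); applied to psi this keeps C in the
budget set, and applied to theta t it gives convergence of the levels of
satisfaction at almost every t. The utility process solves a backward equation
U_t = int_t^T F(s, U_s) ds whose generator F(s, u) = f(s, Y_s, u) is Lipschitz in
u, so by Gronwall and dominated convergence U_0 depends continuously on the
generator ([tail_solution_cvg]). Hence C attains the supremum.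

Uniqueness rests on the comparison principle for these equations: if
V_t = int_t^T g_s ds with g_s <= F(s, V_s), then V <= U, and V_0 = U_0 forces
g_s = F(s, V_s) for almost every s ([tail_comparison], [tail_comparison_eq]).
For two optimal plans apply it to the midpoint of their utility processes: it is
driven by the midpoint of the two integrands, which by concavity lies below the
integrand of the midpoint plan. That plan cannot be strictly better, so equality
holds almost everywhere, and strict concavity gives Y = Y' almost everywhere
([solutions_ae_eq]).

To reach injectivity, Y and Y' must agree at every time. Right-continuity of the
plans settles t < T. Time T is delicate, because mass placed there never
influences the utility. If an optimal plan had a jump at T, part of it could be
spent at time 0 instead, which is at least as good, and strictly better unless
theta s 0 = 0 for almost every s, hence for all s; but then a unit mass at 0
and the zero plan would have the same level of satisfaction, against injectivity
([solution_no_end_mass]). So optimal plans have no mass at T, and the argument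
for t < T works at T from the left.

All facts on dC are derived from Riemann-Stieltjes sums: the integral of a
continuous function over [0, t] is within e * C t of a sum that is linear in C
and uses finitely many values of C ([stieltjes_rs_sum]). Linearity in C,
integrals against step functions and convergence follow from there. *)

Set Implicit Arguments.
Unset Strict Implicit.
Unset Printing Implicit Defensive.

(** * Compactness and right-continuous monotone functions *)

(** The modulus may be taken uniform on a compact set because compact sets are
near-covering: the radius that works near each point works for a whole
neighbourhood, with half the radius left for the second point. *)
Lemma compact_unif_continuous (R : realType) (X : pseudoMetricType R)
    (A : set X) (g : X -> R) : compact A -> {within A, continuous g} ->
  forall e, 0 < e -> exists2 d : R, 0 < d &
    forall x y, A x -> A y -> ball x d y -> `|g x - g y| < e.
Proof.
move=> /compact_near_coveringP cA cg e e0.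
pose P (d : R) (x : X) := forall y, A x -> A y -> ball x d y -> `|g x - g y| < e.
have := cA R (0^'+) P _.
case.
  move=> x Ax; have e20 : 0 < e / 2 by rewrite divr_gt0.
  have /cvgr_dist_lt/(_ _ e20) : g z @[z --> within A (nbhs x)] --> g x.
    by have := cg x; rewrite /continuous_at nbhs_subspace_in.
  rewrite near_withinE => /nbhs_ballP[r /= r0 rP].
  exists (ball x (r / 2), [set d : R | d < r / 2]); first split => /=.
  - by apply: nbhsx_ballx; rewrite divr_gt0.
  - by apply: nbhs_right_lt; rewrite divr_gt0.
  move=> [x' d] /= [xx' dr] y Ax' Ay x'y.
  have h1 := rP x' (le_ball _ xx') Ax'.
  have h2 : `|g x - g y| < e / 2.
    apply: rP => //; rewrite (splitr r); apply: ball_triangle xx' _.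
    exact: le_ball (ltW dr) _ x'y.
  have -> : g x' - g y = - (g x - g x') + (g x - g y) by ring.
  rewrite (splitr e) (le_lt_trans (ler_normD _ _))// ltrD// normrN h1//.
  by rewrite ler_pdivrMr// ler_peMr ?ler1n// ltW.
move=> r /= r0 rP; exists (r / 2); first by rewrite divr_gt0.
move=> x y Ax Ay; apply: rP => //=; rewrite ?divr_gt0//.
by rewrite sub0r normrN gtr0_norm ?divr_gt0// ltr_pdivrMr// ltr_pMr// ltr1n.
Qed.

(** By monotonicity one point to the right of [t] controls a whole right
neighbourhood. *)
Lemma right_continuous_nondecreasing (R : realType) (F : R -> R) :
  nondecreasing F -> (forall t e, 0 < e -> exists2 d, 0 < d & F (t + d) <= F t + e) ->
  right_continuous F.
Proof.
move=> ndF rcF t; apply/cvgrPdist_le => e e0.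
have [d d0 Fd] := rcF t e e0.
near=> s.
have ts : t < s by near: s; exact: nbhs_right_gt.
have sd : s < t + d by near: s; apply: nbhs_right_lt; rewrite ltrDl.
have Fts : F t <= F s by apply: ndF; exact: ltW.
rewrite distrC ger0_norm ?subr_ge0// lerBlDl (le_trans _ Fd)//.
by apply: ndF; exact: ltW.
Unshelve. all: by end_near. Qed.

Lemma cumulative_right_lt (R : realType) (C : cumulative R R) t e :
  0 < e -> exists2 d, 0 < d & C (t + d) <= C t + e.
Proof.
by move=> /(nondecreasing_right_continuousP t C)[d Cd]; exists d%:num.
Qed.

Lemma exists_cumulative (R : realType) (F : R -> R) :
  nondecreasing F -> right_continuous F -> exists C : cumulative R R, C =1 F.
Proof.
move=> ndF rcF.
pose C : cumulative R R :=
  HB.pack_for (cumulative R R) F (isCumulative.Build R _ R F ndF rcF).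
by exists C.
Qed.

(** * Riemann-Stieltjes sums for Lebesgue-Stieltjes integrals *)

(** The elementary estimate behind every Riemann-Stieltjes approximation: one
cell [A] of the partition, of mass [m]. *)
Lemma Rintegral_near_cst d (T : measurableType d) (R : realType)
    (mu : {measure set T -> \bar R}) (A : set T) (g : T -> R) (c e m : R) :
  measurable A -> mu A = m%:E -> mu.-integrable A (EFin \o g) ->
  (forall x, A x -> `|g x - c| <= e) ->
  `|\int[mu]_(x in A) g x - c * m| <= e * m.
Proof.
move=> mA Am ig ge.
have ic r : mu.-integrable A (EFin \o cst r).
  by apply: measurable_bounded_integrable => //; [rewrite Am ltry|exact: bounded_cst].
have -> : m = fine (mu A) by rewrite Am.
rewrite -!Rintegral_cst// -RintegralB//; last exact: ic.
have ib : mu.-integrable A (EFin \o (fun x => g x - c)).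
  by have := integrableB mA ig (ic c); apply: eq_integrable.
apply: (le_trans (le_normr_Rintegral _ _)) => //.
apply: le_Rintegral => //; last exact: ic.
exact: (integrable_norm ib).
Qed.

Section Stieltjes.
Context {R : realType}.
Implicit Types (C : cumulative R R) (g : R -> R) (p : nat -> R) (a b t e : R).

Notation ls := lebesgue_stieltjes_measure.

Lemma stieltjes_oc C a b : a <= b -> ls C `]a, b]%classic = (C b - C a)%:E.
Proof.
move=> ab; rewrite /lebesgue_stieltjes_measure /measure_extension.
rewrite measurable_mu_extE/=; last exact: is_ocitv.
by rewrite wlength_itv_bnd.
Qed.

(** As [C] vanishes on the negative axis, dC has no mass there, so that the
point mass at [0] is all of [C 0] and the closed interval has mass [C a]. *)
Lemma stieltjes_cc0 C a : (forall s, s < 0 -> C s = 0) -> 0 <= a ->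
  ls C `[0, a]%classic = (C a)%:E.
Proof.
move=> C0 a0.
have m1 : ls C `]-1, 0[%classic = 0.
  apply/eqP; rewrite eq_le measure_ge0 andbT.
  have sub : `]-1, 0[%classic `<=` \bigcup_n (`]-1, - (n.+1%:R^-1)]%classic : set R).
    move=> x /=; rewrite in_itv/= => /andP[x1 x0].
    have [n xn] : exists n, n.+1%:R^-1 < - x.
      have [|n] := @ltr_add_invr R 0 (- x); first by rewrite oppr_gt0.
      by rewrite add0r; exists n.
    by exists n => //=; rewrite in_itv/= x1/= lerNr ltW.
  apply: (le_trans (measure_sigma_subadditive (ls C) _ _ sub)) => //.
  rewrite eseries0// => n _ _; apply: (etrans (stieltjes_oc _ _)).
    by rewrite lerN2 invf_le1 ?ler1n.
  by rewrite !C0 ?subrr// oppr_lt0// invr_gt0.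
have h1 : ls C `]-1, a]%classic = (C a)%:E.
  apply: (etrans (stieltjes_oc _ _)); first by rewrite (le_trans _ a0)// lerN10.
  by rewrite (C0 (-1)) ?subr0// ltrN10.
rewrite -h1; have ->
  : `]-1, a]%classic = `]-1, 0[%classic `|` `[0, a]%classic :> set R.
  by rewrite -itv_bndbnd_setU// bnd_simp ?ltrN10.
apply/esym/(etrans (measureU (ls C) _ _ _)) => //; last first.
  exact: (etrans (congr2 adde m1 erefl) (add0e _)).
rewrite -subset0 => x [] /=; rewrite !in_itv/= => /andP[_ x0] /andP[].
by rewrite leNgt x0.
Qed.

Lemma continuous_segment_bounded g a b : {within `[a, b], continuous g} ->
  exists2 B : R, 0 <= B & forall x, a <= x <= b -> `|g x| <= B.
Proof.
move=> cg.
have := continuous_compact cg (@segment_compact R a b).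
move=> /compact_bounded[M [Mr MP]].
exists (`|M| + 1); first by rewrite addr_ge0.
move=> x xab; apply: (MP (`|M| + 1)) => /=.
  by rewrite (le_lt_trans (ler_norm M))// ltrDl.
by exists x => //=; rewrite in_itv.
Qed.

Lemma continuous_stieltjes_integrable C g t : (forall s, s < 0 -> C s = 0) ->
  0 <= t -> {within `[0, t], continuous g} ->
  (ls C).-integrable `[0, t] (EFin \o g).
Proof.
move=> C0 t0 cg; have mt : measurable (`[0, t]%classic : set (measurableTypeR R)).
  exact: measurable_itv.
apply: measurable_bounded_integrable => //.
- by apply: (le_lt_trans (_ : _ <= (C t)%:E)%E); rewrite ?ltry// -stieltjes_cc0.
- exact: (subspace_continuous_measurable_fun mt cg).
- have [B B0 BP] := continuous_segment_bounded cg.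
  exists B; split; first exact: num_real.
  by move=> M BM x /= xt; rewrite (le_trans _ (ltW BM))// BP// -in_itv.
Qed.

(** The first term accounts for the cell [0, p 0], which carries the point mass
at [0]; the tags are the right end points of the cells. *)
Definition rs_sum (g C : R -> R) p n :=
  g (p 0%N) * C (p 0%N) + \sum_(k < n) g (p k.+1) * (C (p k.+1) - C (p k)).

(** The cells [0, p 0] and ]p k, p k.+1] have masses [C (p 0)] and [C (p k.+1) -
C (p k)], which add up to [C (p n)]. *)
Lemma stieltjes_rs_sum C g p n e : (forall s, s < 0 -> C s = 0) ->
  {homo p : i j / (i <= j)%N >-> i <= j} -> 0 <= p 0%N ->
  {within `[0, p n], continuous g} ->
  (forall x, 0 <= x <= p 0%N -> `|g x - g (p 0%N)| <= e) ->
  (forall k, (k < n)%N -> forall x, p k < x <= p k.+1 -> `|g x - g (p k.+1)| <= e) ->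
  `|\int[ls C]_(s in `[0, p n]) g s - rs_sum g C p n| <= e * C (p n).
Proof.
move=> C0 ndp p0 + g0; have pn0 m : 0 <= p m by exact: (le_trans p0 (ndp _ _ _)).
have mt t : measurable (`[0, t]%classic : set (measurableTypeR R)).
  exact: measurable_itv.
have moc a b : measurable (`]a, b]%classic : set (measurableTypeR R)).
  exact: measurable_itv.
elim: n => [cg _|n IH cg gn].
  rewrite /rs_sum big_ord0 addr0.
  apply: (Rintegral_near_cst (mt _) (stieltjes_cc0 C0 p0)).
  - exact: continuous_stieltjes_integrable.
  - by move=> x /=; rewrite in_itv/=; exact: g0.
have pnn : p n <= p n.+1 by exact: ndp.
have ig := continuous_stieltjes_integrable C0 (pn0 n.+1) cg.
have cgn : {within `[0, p n], continuous g}.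
  by apply: continuous_subspaceW cg; apply: subset_itvl; rewrite bnd_simp.
have := IH cgn (fun k kn => gn k (ltnW kn)).
have igo : (ls C).-integrable `]p n, p n.+1] (EFin \o g).
  by apply: integrableS ig => //; apply: subset_itvr; rewrite bnd_simp.
have h1 : `|\int[ls C]_(s in `]p n, p n.+1]) g s - g (p n.+1) * (C (p n.+1) - C (p n))|
    <= e * (C (p n.+1) - C (p n)).
  apply: (Rintegral_near_cst (moc _ _) (stieltjes_oc _ pnn)) => //.
  by move=> x /=; rewrite in_itv/=; exact: gn.
move=> h2.
have -> : `[0, p n.+1]%classic = `[0, p n]%classic `|` `]p n, p n.+1]%classic :> set (measurableTypeR R).
  by rewrite -itv_bndbnd_setU// bnd_simp.
rewrite Rintegral_setU//=; last 2 first.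
- by rewrite -itv_bndbnd_setU// bnd_simp.
- apply/disj_setPS => y [/=]; rewrite 2!in_itv/= => /andP[_ yx] /andP[].
  by rewrite ltNge yx.
rewrite /rs_sum big_ord_recr/= -/(rs_sum g C p n).
have -> : e * C (p n.+1) = e * C (p n) + e * (C (p n.+1) - C (p n)) by ring.
rewrite /rs_sum in h2.
apply: le_trans (lerD h2 h1); apply: le_trans (ler_normD _ _).
by rewrite le_eqVlt; apply/orP; left; apply/eqP; congr (`| _ |); ring.
Qed.

End Stieltjes.

(** * Calculus of Stieltjes integrals of continuous functions *)

Section StieltjesCalculus.
Context {R : realType}.
Implicit Types (C : cumulative R R) (g h : R -> R) (p : nat -> R).
Implicit Types (a b c t e w m B : R).

Notation ls := lebesgue_stieltjes_measure.

Lemma cumulative_ge0 C : (forall s, s < 0 -> C s = 0) -> forall t, 0 <= C t.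
Proof.
move=> C0 t; have [/C0 ->//|t0] := ltP t 0.
rewrite -(C0 (-1)) ?ltrN10//; apply: (cumulative_is_nondecreasing C).
exact: le_trans t0.
Qed.

Lemma stieltjes_cc_bound C g B t : (forall s, s < 0 -> C s = 0) -> 0 <= t ->
  {within `[0, t], continuous g} -> (forall x, 0 <= x <= t -> `|g x| <= B) ->
  `|\int[ls C]_(s in `[0, t]) g s| <= B * C t.
Proof.
move=> C0 t0 cg gB.
have := @Rintegral_near_cst _ _ _ (ls C) _ g 0 B (C t) _ (stieltjes_cc0 C0 t0).
rewrite mul0r subr0; apply; first exact: measurable_itv.
- exact: continuous_stieltjes_integrable.
- by move=> x /=; rewrite in_itv/= subr0; exact: gB.
Qed.

Lemma stieltjes_ge_cst C g m t : (forall s, s < 0 -> C s = 0) -> 0 <= t ->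
  {within `[0, t], continuous g} -> (forall x, 0 <= x <= t -> m <= g x) ->
  m * C t <= \int[ls C]_(s in `[0, t]) g s.
Proof.
move=> C0 t0 cg gm.
have mt : measurable (`[0, t]%classic : set (measurableTypeR R)).
  exact: measurable_itv.
have -> : C t = fine (ls C `[0, t]%classic).
  by apply/esym; exact: (congr1 fine (stieltjes_cc0 C0 t0)).
rewrite -Rintegral_cst//; apply: le_Rintegral => //.
- apply: (@continuous_stieltjes_integrable _ _ (cst m)) => //.
  by move=> x; exact: cst_continuous.
- exact: continuous_stieltjes_integrable.
Qed.

Lemma stieltjes_dist C g h w t : (forall s, s < 0 -> C s = 0) -> 0 <= t ->
  {within `[0, t], continuous g} -> {within `[0, t], continuous h} ->
  (forall x, 0 <= x <= t -> `|g x - h x| <= w) ->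
  `|\int[ls C]_(s in `[0, t]) g s - \int[ls C]_(s in `[0, t]) h s| <= w * C t.
Proof.
move=> C0 t0 cg ch gh; rewrite -RintegralB//; last 2 first.
- exact: continuous_stieltjes_integrable.
- exact: continuous_stieltjes_integrable.
have cgh : {within `[0, t], continuous (fun s => g s - h s)}.
  by move=> x; apply: continuousB; [exact: cg|exact: ch].
exact: (stieltjes_cc_bound C0 t0 cgh gh).
Qed.

Lemma stieltjes_increment C g B a b : (forall s, s < 0 -> C s = 0) ->
  0 <= a <= b -> {within `[0, b], continuous g} ->
  (forall x, a < x <= b -> `|g x| <= B) ->
  `|\int[ls C]_(s in `[0, b]) g s - \int[ls C]_(s in `[0, a]) g s|
    <= B * (C b - C a).
Proof.
move=> C0 /andP[a0 ab] cg gB.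
have mt t : measurable (`[0, t]%classic : set (measurableTypeR R)).
  exact: measurable_itv.
have moc : measurable (`]a, b]%classic : set (measurableTypeR R)).
  exact: measurable_itv.
have ig := continuous_stieltjes_integrable C0 (le_trans a0 ab) cg.
have E : `[0, b]%classic = `[0, a]%classic `|` `]a, b]%classic :> set (measurableTypeR R).
  by rewrite -itv_bndbnd_setU// bnd_simp.
rewrite {1}E Rintegral_setU//; last 2 first.
- by rewrite -E.
- apply/disj_setPS => y [/=]; rewrite 2!in_itv/= => /andP[_ yx] /andP[].
  by rewrite ltNge yx.
rewrite addrC addKr.
have := @Rintegral_near_cst _ _ _ (ls C) _ g 0 B _ moc (stieltjes_oc C ab).
rewrite mul0r subr0; apply.
- by apply: integrableS ig => //; apply: subset_itvr; rewrite bnd_simp.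
- by move=> x /=; rewrite in_itv/= subr0; exact: gB.
Qed.

(** The partition points below [t] can be taken in any dense set. This freedom
is used to avoid the jumps of a limit plan. *)
Lemma fine_partition (G : set R) g t e : (forall a b, a < b ->
  exists2 x, G x & a < x < b) ->
  0 <= t -> {within `[0, t], continuous g} -> 0 < e ->
  exists p n, [/\ {homo p : i j / (i <= j)%N >-> i <= j}, 0 <= p 0%N,
    p n = t & forall k, (k < n)%N -> G (p k) /\ p k < t] /\
    (forall x, 0 <= x <= p 0%N -> `|g x - g (p 0%N)| <= e) /\
    (forall k, (k < n)%N -> forall x, p k < x <= p k.+1 -> `|g x - g (p k.+1)| <= e).
Proof.
move=> dG t0 cg e0; move: t0; rewrite le_eqVlt => /predU1P[t0|t0].
  exists (fun=> t), 0%N; split; [split => //; by rewrite t0|split => // x].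
  by rewrite -t0 => xx; rewrite (le_anti xx) subrr normr0 ltW.
have [d d0 dP] := compact_unif_continuous (@segment_compact R 0 t) cg e0.
have [N Nd] : exists N : nat, 2 * t / N.+1%:R < d.
  have [|N] := @ltr_add_invr R 0 (d / (2 * t)).
    by rewrite divr_gt0// mulr_gt0.
  by rewrite add0r ltr_pdivlMr ?mulr_gt0// mulrC => ?; exists N.
set n := N.+1; have n0 : 0 < n%:R :> R by rewrite ltr0n.
pose q k : R := t * k%:R / n%:R.
have qS k : q k < q k.+1.
  by rewrite /q ltr_pM2r ?invr_gt0// ltr_pM2l// ltr_nat.
have qh k : q k.+1 - q k = t / n%:R.
  by rewrite /q -natr1; field; rewrite gt_eqF.
have qn : q n = t by rewrite /q mulfK// gt_eqF.
have qnd : {homo q : i j / (i <= j)%N >-> i <= j}.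
  by apply: homo_leq => [//|? ? ?|k]; [exact: le_trans|exact: ltW].
have /choice[r rP] : forall k, exists x, G x /\ q k < x < q k.+1.
  by move=> k; have [x Gx xk] := dG _ _ (qS k); exists x.
pose p k := if (k < n)%N then r k else t.
have pt k : (k < n)%N -> p k < t.
  move=> kn; rewrite /p kn -qn; have [_ /andP[_ h]] := rP k.
  by apply: (lt_le_trans h); apply: qnd.
have pS k : p k <= p k.+1.
  have [kn|kn] := ltnP k.+1 n; last first.
    rewrite {2}/p ltnNge kn/=; have [kn'|kn'] := ltnP k n; first exact/ltW/pt.
    by rewrite /p ltnNge kn'.
  rewrite /p kn (ltnW kn); have [_ /andP[_ h1]] := rP k.
  by have [_ /andP[h2 _]] := rP k.+1; exact/ltW/(lt_trans h1).
have pnd : {homo p : i j / (i <= j)%N >-> i <= j}.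
  by apply: homo_leq => [//|? ? ?|k]; [exact: le_trans|exact: pS].
have q0 : q 0%N = 0 by rewrite /q mulr0 mul0r.
have p00 : 0 < p 0%N by rewrite /p ltn0Sn -q0; have [_ /andP[]] := rP 0%N.
have small x y : 0 <= x -> x <= y -> y <= t -> y - x < d -> `|g x - g y| <= e.
  move=> x0 xy yt xyd; apply/ltW/dP => /=; rewrite ?in_itv/= ?x0 ?yt ?andbT//.
  - exact: le_trans yt.
  - exact: le_trans xy.
  - by rewrite -ball_normE/= distrC ger0_norm// subr_ge0.
have td : t / n%:R < d.
  by apply: le_lt_trans Nd; rewrite ler_pM2r ?invr_gt0//; lra.
exists p, n; split; first split => //.
- exact: ltW.
- by rewrite /p ltnn.
- by move=> k kn; split; [rewrite /p kn; case: (rP k)|exact: pt].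
split=> [x /andP[x0 xp]|k kn x /andP[kx xk]].
  apply: small => //; first exact/ltW/pt.
  rewrite /p ltn0Sn in xp *.
  have [_ /andP[_ h]] := rP 0%N.
  by apply: le_lt_trans td;
    rewrite -(qh 0%N) q0 subr0 lerBlDr (le_trans (ltW h))// lerDl.
have pkt : p k.+1 <= t.
  by have := pnd _ _ kn; rewrite {2}/p ltnn.
apply: small => //.
  by rewrite (le_trans _ (ltW kx))// (le_trans (ltW p00))// pnd.
apply: le_lt_trans Nd; apply: (@le_trans _ _ (p k.+1 - p k)).
  by rewrite lerD2l lerN2 ltW.
rewrite -/n; have -> : 2 * t / n%:R = q k.+2 - q k.
  by rewrite -(subrKA (q k.+1)) !qh -mulrDl -mulr2n mulr_natl.
rewrite lerB//.
  rewrite /p; case: ifP => kn1; first by have [_ /andP[_ h]] := rP k.+1; exact: ltW.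
  by rewrite -qn; apply: qnd; apply: leqW; rewrite leqNgt kn1.
by rewrite {1}/p kn; have [_ /andP[h _]] := rP k; exact: ltW.
Qed.

Lemma fine_rs_sum (G : set R) g t e :
  (forall a b, a < b -> exists2 x, G x & a < x < b) ->
  0 <= t -> {within `[0, t], continuous g} -> 0 < e ->
  exists p n, [/\ p n = t, forall k, (k < n)%N -> G (p k) /\ 0 <= p k < t,
     0 <= p 0%N, (forall x, 0 <= x <= p 0%N -> `|g x - g (p 0%N)| <= e) &
     forall C, (forall s, s < 0 -> C s = 0) ->
       `|\int[ls C]_(s in `[0, t]) g s - rs_sum g C p n| <= e * C t].
Proof.
move=> dG t0 cg e0.
have [p [n [[pnd p0 pn pG] [osc0 osc1]]]] := fine_partition dG t0 cg e0.
exists p, n; split => //.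
  move=> k kn; have [Gk ->] := pG _ kn; split => //; rewrite andbT.
  exact: (le_trans p0 (pnd 0%N k _)).
by move=> C C0; rewrite -pn; apply: stieltjes_rs_sum => //; rewrite pn.
Qed.

Let dT (a b : R) : a < b -> exists2 x, [set: R] x & a < x < b.
Proof. by move=> ab; exists ((a + b) / 2) => //; rewrite !midf_lt. Qed.

(** Identities between integrals are obtained by comparing both sides with the
same Riemann-Stieltjes sum and letting the mesh tend to zero. *)
Lemma eq_of_dist_le (x y K : R) : 0 <= K ->
  (forall e, 0 < e -> `|x - y| <= e * K) -> x = y.
Proof.
move=> K0 h; apply/eqP; rewrite -subr_eq0 -normr_le0; apply/ler_addgt0Pr => e e0.
have K1 : 0 < K + 1 by rewrite ltr_wpDl.
rewrite add0r (le_trans (h (e / (K + 1)) _)) ?divr_gt0//.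
by rewrite mulrAC ler_pdivrMr// ler_wpM2l ?ltW// ltrDl.
Qed.

(** Riemann-Stieltjes sums are linear in the distribution function; the
coefficients may be negative, so that mass can also be removed. *)
Lemma stieltjes_linear C1 C2 C3 a b g t :
  (forall s, s < 0 -> C1 s = 0) -> (forall s, s < 0 -> C2 s = 0) ->
  (forall s, s < 0 -> C3 s = 0) -> (forall s, 0 <= s <= t ->
    C3 s = a * C1 s + b * C2 s) ->
  0 <= t -> {within `[0, t], continuous g} ->
  \int[ls C3]_(s in `[0, t]) g s =
  a * \int[ls C1]_(s in `[0, t]) g s + b * \int[ls C2]_(s in `[0, t]) g s.
Proof.
move=> C10 C20 C30 C3E t0 cg.
apply: (@eq_of_dist_le _ _ (C3 t + `|a| * C1 t + `|b| * C2 t)).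
  by rewrite !addr_ge0// ?mulr_ge0// cumulative_ge0.
move=> e e0; have [p [n [pn pk p0 _ rsP]]] := fine_rs_sum dT t0 cg e0.
have pin k : (k <= n)%N -> 0 <= p k <= t.
  rewrite leq_eqVlt => /predU1P[->|/pk[_ /andP[-> /ltW//]]].
  by rewrite pn t0 lexx.
have rsE : rs_sum g C3 p n = a * rs_sum g C1 p n + b * rs_sum g C2 p n.
  rewrite /rs_sum !mulrDr !mulr_sumr addrACA -big_split/= C3E ?pin//.
  congr (_ + _); first by ring.
  by apply: eq_bigr => k _; rewrite !C3E ?pin// ?(ltnW (ltn_ord k))//; ring.
have h1 := rsP C1 C10; have h2 := rsP C2 C20; have h3 := rsP C3 C30.
move: h1 h2 h3; set I1 := \int[ls C1]_(_ in _) _; set I2 := \int[ls C2]_(_ in _) _.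
set I3 := \int[ls C3]_(_ in _) _ => h1 h2; rewrite rsE => h3.
have -> : I3 - (a * I1 + b * I2) = (I3 - (a * rs_sum g C1 p n + b * rs_sum g C2 p n))
   - a * (I1 - rs_sum g C1 p n) - b * (I2 - rs_sum g C2 p n) by ring.
rewrite (le_trans (ler_normB _ _))// (le_trans (lerD (ler_normB _ _) (lexx _)))//.
rewrite [leRHS]mulrDr [e * (_ + _)]mulrDr 2!normrM.
by apply: lerD; [apply: lerD => //|]; rewrite mulrCA ler_wpM2l.
Qed.

Lemma stieltjes_step0 C c g t : (forall s, C s = if s < 0 then 0 else c) ->
  0 <= t -> {within `[0, t], continuous g} ->
  \int[ls C]_(s in `[0, t]) g s = c * g 0.
Proof.
move=> CE t0 cg; have C0 s : s < 0 -> C s = 0 by move=> s0; rewrite CE s0.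
have c0 : 0 <= c by have := cumulative_ge0 C0 0; rewrite CE ltxx.
apply: (@eq_of_dist_le _ _ (c + c)); first by rewrite addr_ge0.
move=> e e0; have [p [n [pn pk p0 o1 /(_ C C0)]]] := fine_rs_sum dT t0 cg e0.
have pin k : (k <= n)%N -> 0 <= p k.
  rewrite leq_eqVlt => /predU1P[->|/pk[_ /andP[-> /ltW//]]].
  by rewrite pn.
have -> : rs_sum g C p n = c * g (p 0%N).
  rewrite /rs_sum big1 => [|k _].
    by rewrite addr0 (CE (p 0%N)) ltNge p0 mulrC.
  by rewrite (CE (p k.+1)) (CE (p k)) !ltNge !pin ?subrr ?mulr0// ltnW.
rewrite (CE t) ltNge t0/= => h.
have -> : \int[ls C]_(s in `[0, t]) g s - c * g 0 =
  \int[ls C]_(s in `[0, t]) g s - c * g (p 0%N) - c * (g 0 - g (p 0%N)) by ring.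
rewrite (le_trans (ler_normB _ _))// [leRHS]mulrDr lerD//.
by rewrite normrM (ger0_norm c0) mulrC ler_wpM2r// o1// lexx p0.
Qed.

Lemma stieltjes_step_end C c g t : (forall s, C s = if s < t then 0 else c) ->
  0 <= t -> {within `[0, t], continuous g} ->
  \int[ls C]_(s in `[0, t]) g s = c * g t.
Proof.
move=> CE t0 cg.
have C0 s : s < 0 -> C s = 0 by move=> s0; rewrite CE (lt_le_trans s0 t0).
have c0 : 0 <= c by have := cumulative_ge0 C0 t; rewrite CE ltxx.
apply: (@eq_of_dist_le _ _ c) => //.
move=> e e0; have [p [n [pn pk p0 o1 /(_ C C0)]]] := fine_rs_sum dT t0 cg e0.
rewrite (CE t) ltxx; case: n pn pk => [|n] pn pk.
  by rewrite /rs_sum big_ord0 addr0 pn (CE t) ltxx [c * _]mulrC.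
rewrite /rs_sum big_ord_recr/= big1 => [|k _]; last first.
  have [_ /andP[_ h1]] := pk k (ltn_trans (ltn_ord k) (ltnSn _)).
  have [_ /andP[_ h2]] := pk k.+1 (ltn_ord k).
  by rewrite (CE (p k.+1)) (CE (p k)) h1 h2 subrr mulr0.
have [_ /andP[_ h1]] := pk n (ltnSn _).
have [_ /andP[_ h2]] := pk 0%N (ltn0Sn _).
by rewrite pn (CE t) (CE (p n)) (CE (p 0%N)) h1 h2 ltxx subr0 mulr0 !add0r [c * _]mulrC.
Qed.

(** A Riemann-Stieltjes sum with points in [G] involves only values of the plans
where convergence is assumed, and the approximation error is uniform because the
masses are bounded by [M]. *)
Lemma stieltjes_cvg (Cn : nat -> cumulative R R) C (G : set R) g t M :
  (forall n s, s < 0 -> Cn n s = 0) -> (forall s, s < 0 -> C s = 0) ->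
  (forall n, Cn n t <= M) ->
  (forall a b, a < b -> exists2 x, G x & a < x < b) ->
  (forall s, G s -> Cn n s @[n --> \oo] --> C s) ->
  Cn n t @[n --> \oo] --> C t ->
  0 <= t -> {within `[0, t], continuous g} ->
  \int[ls (Cn n)]_(s in `[0, t]) g s @[n --> \oo] --> \int[ls C]_(s in `[0, t]) g s.
Proof.
move=> Cn0 C0 CnM dG CG Ct t0 cg; apply/cvgrPdist_le => e e0.
have M0 : 0 <= M by apply: le_trans (CnM 0%N); exact: (cumulative_ge0 (Cn0 0%N)).
have CM : C t <= M.
  by rewrite -(cvg_lim _ Ct)//; apply: limr_le; [apply/cvg_ex;
    exists (C t)|exact: nearW].
(* Each of the two approximation errors is at most e' * M, and the sums differ
   by at most e'. *)
pose e' := e / (2 * M + 1).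
have M1 : 0 < 2 * M + 1 by lra.
have e'0 : 0 < e' by rewrite divr_gt0.
have [p [n [pn pk p0 _ rsP]]] := fine_rs_sum dG t0 cg e'0.
have pin k : (k <= n)%N -> Cn m (p k) @[m --> \oo] --> C (p k).
  rewrite leq_eqVlt => /predU1P[->|/pk[/CG//]]; by rewrite pn.
have : rs_sum g (Cn m) p n @[m --> \oo] --> rs_sum g C p n.
  apply: cvgD; first by apply: cvgMr; exact: pin.
  by apply: cvg_big => [|k _]; [exact: add_continuous|apply: cvgMr; apply: cvgB;
    apply: pin => //; exact: ltnW].
move=> /cvgrPdist_le/(_ _ e'0); apply: filterS => m hm.
have h1 := rsP C C0; have h2 := rsP (Cn m) (Cn0 m).
set I := \int[ls C]_(_ in _) _ in h1 *; set J := \int[ls (Cn m)]_(_ in _) _ in h2 *.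
have -> : I - J = (I - rs_sum g C p n) + (rs_sum g C p n - rs_sum g (Cn m) p n)
   - (J - rs_sum g (Cn m) p n) by ring.
rewrite (le_trans (ler_normB _ _))// (le_trans (lerD (ler_normD _ _) (lexx _)))//.
rewrite (le_trans (lerD (lerD h1 hm) h2))//.
have -> : e = e' * (2 * M + 1) by rewrite /e' divfK// gt_eqF.
rewrite (@le_trans _ _ (e' * M + e' + e' * M))//; last by rewrite le_eqVlt;
  apply/orP; left; apply/eqP; ring.
by rewrite !lerD// ler_wpM2l// ltW.
Qed.

End StieltjesCalculus.

(** * Bounded measurable functions on segments *)

Section BoundedMeasurable.
Context {R : realType}.
Implicit Types (h g : R -> R) (a b c s t K e : R).

Notation mu := (@lebesgue_measure R).

(** Every integrand and every utility process below has this property on [0, T];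
it is stable under the operations in use and ensures integrability on every
subsegment. *)
Definition bounded_measurable (D : set R) h :=
  measurable_fun D h /\ exists B : R, forall s, D s -> `|h s| <= B.

Lemma bm_integrable a b s t h : bounded_measurable `[a, b] h ->
  a <= s -> t <= b -> mu.-integrable `[s, t] (EFin \o h).
Proof.
move=> [mh [B hB]] as_ tb.
have sub : `[s, t]%classic `<=` `[a, b]%classic.
  by apply: subset_itv; rewrite bnd_simp.
suff ih : mu.-integrable `[a, b] (EFin \o h) by apply: integrableS ih.
have fin : (mu `[a, b]%classic < +oo)%E.
  by rewrite lebesgue_measure_itv/=; case: ifP; rewrite ltry.
apply: measurable_bounded_integrable => //.
by exists B; split; [exact: num_real|move=> M BM x /hB/le_trans; apply; exact: ltW].
Qed.

Lemma bmW a b s t h : a <= s -> t <= b ->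
  bounded_measurable `[a, b] h -> bounded_measurable `[s, t] h.
Proof.
move=> as_ tb [mh [B hB]].
have sub : `[s, t]%classic `<=` `[a, b]%classic.
  by apply: subset_itv; rewrite bnd_simp.
split; first by apply: measurable_funS mh.
by exists B => x /sub/hB.
Qed.

Lemma eq_bm (D : set R) h g : {in D, h =1 g} -> bounded_measurable D h ->
  bounded_measurable D g.
Proof.
move=> hg [mh [B hB]]; split; first exact: (eq_measurable_fun h).
by exists B => s Ds; rewrite -hg ?inE//; exact: hB.
Qed.

Lemma bm_cst (D : set R) c : bounded_measurable D (fun=> c).
Proof. by split; [exact: measurable_cst|exists `|c|]. Qed.

Lemma bmD (D : set R) h g : bounded_measurable D h -> bounded_measurable D g ->
  bounded_measurable D (fun s => h s + g s).
Proof.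
move=> [mh [B hB]] [mg [B' gB']]; split; first exact: measurable_funD.
by exists (B + B') => s Ds; rewrite (le_trans (ler_normD _ _))// lerD ?hB ?gB'.
Qed.

Lemma bmZ (D : set R) c h : bounded_measurable D h ->
  bounded_measurable D (fun s => c * h s).
Proof.
move=> [mh [B hB]]; split; first exact: measurable_funM.
by exists (`|c| * B) => s Ds; rewrite normrM ler_wpM2l// hB.
Qed.

Lemma bmB (D : set R) h g : bounded_measurable D h -> bounded_measurable D g ->
  bounded_measurable D (fun s => h s - g s).
Proof.
move=> bh /(bmZ (-1)) bg; apply: eq_bm (bmD bh bg) => s _.
by rewrite mulN1r.
Qed.

Lemma bm_norm (D : set R) h : bounded_measurable D h ->
  bounded_measurable D (fun s => `|h s|).
Proof.
move=> [mh [B hB]]; split; first exact: measurableT_comp.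
by exists B => s Ds; rewrite normr_id hB.
Qed.

Lemma continuous_bm a b h : {within `[a, b], continuous h} ->
  bounded_measurable `[a, b] h.
Proof.
move=> ch; split.
  by apply: (@subspace_continuous_measurable_fun _ `[a, b]%classic).
have [B _ hB] := continuous_segment_bounded ch.
by exists B => s /=; rewrite in_itv; exact: hB.
Qed.

Lemma nondecreasing_bm a b h : nondecreasing h -> bounded_measurable `[a, b] h.
Proof.
move=> ndh; split.
  by apply: nondecreasing_measurable => //; rewrite set_itvE; exact: measurable_itv.
exists (`|h a| + `|h b|) => s /=; rewrite in_itv/= => /andP[/ndh ha /ndh hb].
rewrite ler_norml; apply/andP; split.
  by rewrite (le_trans _ ha)// lerNl (le_trans (ler_norm _))// normrN lerDl.
by rewrite (le_trans hb)// (le_trans (ler_norm _))// lerDr.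
Qed.

Lemma Rintegral_itv_cat a b c h : bounded_measurable `[a, c] h -> a <= b <= c ->
  \int[mu]_(s in `[a, c]) h s =
  \int[mu]_(s in `[a, b]) h s + \int[mu]_(s in `[b, c]) h s.
Proof.
move=> bh /andP[ab bc].
have ih := bm_integrable bh (lexx a) (lexx c).
have ihbc : mu.-integrable `]b, c] (EFin \o h).
  by apply: integrableS ih => //; apply: subset_itv; rewrite bnd_simp.
rewrite -(Rintegral_itv_obnd_cbnd ihbc) -(@Rintegral_itvB _ h (BLeft a) (BRight c) b)//.
by rewrite addrC subrK.
Qed.

Lemma Rintegral_itv_bound a b h B : a <= b -> bounded_measurable `[a, b] h ->
  (forall s, a <= s <= b -> `|h s| <= B) ->
  `|\int[mu]_(s in `[a, b]) h s| <= B * (b - a).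
Proof.
move=> ab bh hB; have ih := bm_integrable bh (lexx a) (lexx b).
have m : mu `[a, b]%classic = (b - a)%:E.
  rewrite lebesgue_measure_itv/= lte_fin; case: ltgtP ab => // -> _.
  by rewrite subrr.
have := @Rintegral_near_cst _ _ _ mu `[a, b]%classic h 0 B (b - a).
rewrite mul0r subr0; apply => //; last first.
  by move=> x /=; rewrite in_itv/= subr0; exact: hB.
Qed.

Lemma le_Rintegral_itv a b h g : bounded_measurable `[a, b] h ->
  bounded_measurable `[a, b] g -> (forall s, a <= s <= b -> h s <= g s) ->
  \int[mu]_(s in `[a, b]) h s <= \int[mu]_(s in `[a, b]) g s.
Proof.
move=> bh bg hg; apply: le_Rintegral => //.
- exact: (bm_integrable bh).
- exact: (bm_integrable bg).
Qed.

Lemma le_norm_Rintegral_itv a b h : bounded_measurable `[a, b] h ->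
  `|\int[mu]_(s in `[a, b]) h s| <= \int[mu]_(s in `[a, b]) `|h s|.
Proof.
by move=> bh; apply: le_normr_Rintegral => //; exact: (bm_integrable bh).
Qed.

Lemma RintegralB_itv a b h g : bounded_measurable `[a, b] h ->
  bounded_measurable `[a, b] g ->
  \int[mu]_(s in `[a, b]) (h s - g s) =
  \int[mu]_(s in `[a, b]) h s - \int[mu]_(s in `[a, b]) g s.
Proof.
move=> bh bg; apply: RintegralB => //.
- exact: (bm_integrable bh).
- exact: (bm_integrable bg).
Qed.

Lemma RintegralD_itv a b h g : bounded_measurable `[a, b] h ->
  bounded_measurable `[a, b] g ->
  \int[mu]_(s in `[a, b]) (h s + g s) =
  \int[mu]_(s in `[a, b]) h s + \int[mu]_(s in `[a, b]) g s.
Proof.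
move=> bh bg; apply: RintegralD => //.
- exact: (bm_integrable bh).
- exact: (bm_integrable bg).
Qed.

Lemma RintegralZ_itv a b c h : bounded_measurable `[a, b] h ->
  \int[mu]_(s in `[a, b]) (c * h s) = c * \int[mu]_(s in `[a, b]) h s.
Proof. by move=> bh; apply: RintegralZl => //; exact: (bm_integrable bh). Qed.

Lemma tail_integral_bm a b h : a <= b -> mu.-integrable `[a, b] (EFin \o h) ->
  bounded_measurable `[a, b] (fun t => \int[mu]_(s in `[t, b]) h s).
Proof.
move=> ab ih.
have c := parameterized_integral_continuous ab ih.
have bc := bmB (bm_cst `[a, b] (\int[mu]_(s in `[a, b]) h s)) (continuous_bm c).
apply: eq_bm bc => t; rewrite inE/= in_itv/= => /andP[at_ tb].
rewrite /parameterized_integral (@Rintegral_itvB _ h (BLeft a) (BRight b) t)//.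
rewrite Rintegral_itv_obnd_cbnd//.
by apply: integrableS ih => //; apply: subset_itv; rewrite bnd_simp.
Qed.

Lemma Rintegral_expR a b c : a <= b -> c != 0 ->
  \int[mu]_(s in `[a, b]) expR (c * s) = (expR (c * b) - expR (c * a)) / c.
Proof.
move=> ab c0; move: ab; rewrite le_eqVlt => /predU1P[->|ab].
  by rewrite subrr mul0r set_itv1 Rintegral_set1.
pose F s : R := expR (c * s) / c.
have dF (x : R) : is_derive x 1 F (expR (c * x)).
  apply: is_derive_eq; rewrite /GRing.scale/= !mulr1 !mulr0 ?addr0 ?add0r.
  by rewrite mulrCA mulVf// mulr1.
have cF : continuous F by move=> x; apply: differentiable_continuous;
  exact/derivable1_diffP.
rewrite /Rintegral (@continuous_FTC2 _ _ F)//=.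
- by rewrite /F mulrBl.
- apply: continuous_subspaceT => x.
  apply: continuous_comp; last exact: continuous_expR.
  by apply: cvgMr; exact: cvg_id.
- split.
  + by move=> x _; exact: ex_derive.
  + by apply: cvg_at_right_filter; exact: cF.
  + by apply: cvg_at_left_filter; exact: cF.
- by move=> x _; rewrite derive1E; exact: derive_val.
Qed.

End BoundedMeasurable.

(** * Weighted Gronwall inequalities *)

Section Gronwall.
Context {R : realType}.
Implicit Types (W phi : R -> R) (a b K e t : R).

Notation mu := (@lebesgue_measure R).

(** If [phi <= m * W], integrating gives [phi <= (e + m / 2) * W]; for [m] the
least such constant this yields [m <= 2 * e]. Working with the best constant
replaces the usual iteration, and the same proof serves both time directions. *)
Lemma gronwall_weight (I : set R) (J : R -> interval R) W phi K e :
  0 <= K -> 0 <= e ->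
  (forall t, I t -> 0 < W t) ->
  (forall t, I t -> [set` J t] `<=` I) ->
  (forall t, I t -> mu.-integrable [set` J t] (EFin \o W)) ->
  (forall t, I t -> mu.-integrable [set` J t] (EFin \o phi)) ->
  (forall t, I t -> K * \int[mu]_(s in [set` J t]) W s <= W t / 2) ->
  (exists B, forall t, I t -> phi t <= B * W t) ->
  (forall t, I t -> phi t <= e * W t + K * \int[mu]_(s in [set` J t]) phi s) ->
  forall t, I t -> phi t <= 2 * e * W t.
Proof.
move=> K0 e0 W0 JI iW iphi KW [B phiB] phiP t It.
pose S := [set phi s / W s | s in I].
have supS : has_sup S.
  split; first by exists (phi t / W t), t.
  by exists B => _ [s Is <-]; rewrite ler_pdivrMr ?W0 ?phiB.
have phim s : I s -> phi s <= sup S * W s.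
  by move=> Is; rewrite -ler_pdivrMr ?W0//; apply: sup_upper_bound => //; exists s.
suff m2 : sup S <= 2 * e.
  by rewrite (le_trans (phim _ It))// ler_wpM2r// ltW// W0.
have [m0|m0] := leP (sup S) 0; first by rewrite (le_trans m0)// mulr_ge0.
suff : sup S <= e + sup S / 2 by lra.
apply: ge_sup; first by case: supS.
move=> _ [s Is <-]; rewrite ler_pdivrMr ?W0// (le_trans (phiP _ Is))//.
rewrite mulrDl lerD2l mulrAC -mulrA;
  apply: (@le_trans _ _ (sup S * (K * \int[mu]_(x in [set` J s]) W x))).
  rewrite mulrCA ler_wpM2l// -RintegralZl//; last exact: iW.
  apply: le_Rintegral => //; first exact: iphi.
    by apply: eq_integrable (integrableZl _ (sup S) (iW _ Is)).
  by move=> x /(JI _ Is); exact: phim.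
rewrite ler_wpM2l ?(ltW m0)//; exact: KW.
Qed.

Lemma expR_weight_bm a b c : bounded_measurable `[a, b] (fun s => expR (c * s)).
Proof.
apply: continuous_bm; apply: continuous_subspaceT => x.
apply: continuous_comp; last exact: continuous_expR.
by apply: cvgMr; exact: cvg_id.
Qed.

(** An exponential with rate twice the Lipschitz constant is a weight for which
the integral operator is a contraction with factor 1/2. *)
Lemma weight_backward a b K : 0 < K -> a <= b ->
  K * \int[mu]_(s in `[a, b]) expR (- (2 * K) * s) <= expR (- (2 * K) * a) / 2.
Proof.
move=> K0 ab; rewrite Rintegral_expR//; last by rewrite oppr_eq0 mulf_neq0 ?gt_eqF.
have -> : K * ((expR (- (2 * K) * b) - expR (- (2 * K) * a)) / - (2 * K)) =
  expR (- (2 * K) * a) / 2 - expR (- (2 * K) * b) / 2.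
  by field; rewrite gt_eqF.
by rewrite gerBl divr_ge0// expR_ge0.
Qed.

Lemma weight_forward a b K : 0 < K -> a <= b ->
  K * \int[mu]_(s in `[a, b]) expR ((2 * K) * s) <= expR ((2 * K) * b) / 2.
Proof.
move=> K0 ab; rewrite Rintegral_expR//; last by rewrite mulf_neq0 ?gt_eqF.
have -> : K * ((expR ((2 * K) * b) - expR ((2 * K) * a)) / (2 * K)) =
  expR ((2 * K) * b) / 2 - expR ((2 * K) * a) / 2.
  by field; rewrite gt_eqF.
by rewrite gerBl divr_ge0// expR_ge0.
Qed.

Lemma bounded_by_weight a b c h : bounded_measurable `[a, b] h ->
  exists B, 0 <= B /\ forall t, a <= t <= b -> `|h t| <= B * expR (c * t).
Proof.
move=> [_ [B hB]].
have [_ [B' hB']] := expR_weight_bm a b (- c).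
exists (`|B| * `|B'|); split; first by rewrite mulr_ge0.
move=> t tab; have Dt : `[a, b]%classic t by rewrite /= in_itv.
apply: (@le_trans _ _ (`|B| * (expR (- c * t) * expR (c * t)))).
  by rewrite -expRD mulNr addNr expR0 mulr1 (le_trans (hB _ Dt))// ler_norm.
rewrite -mulrA ler_wpM2l// ler_wpM2r ?expR_ge0//.
by rewrite (le_trans (ler_norm _))// (le_trans (hB' _ Dt))// ler_norm.
Qed.

Lemma gronwall_backward a b K e phi : 0 < K -> 0 <= e ->
  bounded_measurable `[a, b] phi ->
  (forall t, a <= t <= b -> phi t <= e + K * \int[mu]_(s in `[t, b]) phi s) ->
  forall t, a <= t <= b -> phi t <= 2 * e * expR (2 * K * (b - a)).
Proof.
move=> K0 e0 bphi phiP t /[dup] tab /andP[at_ tb].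
have ab := le_trans at_ tb.
pose W s := expR (- (2 * K) * s).
have -> : 2 * e * expR (2 * K * (b - a)) = 2 * (e * expR (2 * K * b)) * W a.
  by rewrite -!mulrA -expRD; congr (_ * (_ * expR _)); ring.
have Wa s : a <= s -> W s <= W a.
  by move=> as_; rewrite ler_expR !mulNr lerN2 ler_pM2l// mulr_gt0.
apply: (@le_trans _ _ (2 * (e * expR (2 * K * b)) * W t)); last first.
  by rewrite ler_wpM2l ?Wa// !mulr_ge0// expR_ge0.
have sub s : `[a, b]%classic s -> `[s, b] `<=` `[a, b]%classic.
  by rewrite /= in_itv/= => /andP[as_ sb]; apply: subset_itv; rewrite bnd_simp.
apply: (@gronwall_weight `[a, b]%classic (fun s => `[s, b]) W phi K) => //.
- exact: ltW.
- by rewrite mulr_ge0// expR_ge0.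
- by move=> s _; exact: expR_gt0.
- by move=> s /=; rewrite in_itv/= => /andP[as_ sb];
  apply: (bm_integrable (expR_weight_bm _ _ _) as_ (lexx b)).
- by move=> s /=; rewrite in_itv/= => /andP[as_ sb];
  apply: (bm_integrable bphi as_ (lexx b)).
- by move=> s /=; rewrite in_itv/= => /andP[as_ sb]; exact: weight_backward.
- have [B [_ hB]] := bounded_by_weight (- (2 * K)) bphi.
  by exists B => s /=; rewrite in_itv/= => /hB; apply: le_trans; exact: ler_norm.
- move=> s /=; rewrite in_itv/= => /[dup] sab /andP[_ sb].
  rewrite (le_trans (phiP _ sab))// lerD2r -mulrA ler_peMr// -expRD -expR0.
  by rewrite ler_expR mulNr -mulrBr mulr_ge0 ?subr_ge0// mulr_ge0// ltW.
Qed.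

(** Serves to propagate the equality of two utility processes at time 0 to all
later times. *)
Lemma gronwall_forward a b K phi : 0 < K -> bounded_measurable `[a, b] phi ->
  (forall t, a <= t <= b -> phi t <= K * \int[mu]_(s in `[a, t]) phi s) ->
  forall t, a <= t <= b -> phi t <= 0.
Proof.
move=> K0 bphi phiP t tab; pose W s := expR ((2 * K) * s).
have -> : 0 = 2 * 0 * W t by rewrite mulr0 mul0r.
apply: (@gronwall_weight `[a, b]%classic (fun s => `[a, s]) W phi K) => //.
- exact: ltW.
- by move=> s _; exact: expR_gt0.
- by move=> s; rewrite /= in_itv/= => /andP[as_ sb]; apply: subset_itv;
  rewrite bnd_simp.
- by move=> s /=; rewrite in_itv/= => /andP[as_ sb];
  apply: (bm_integrable (expR_weight_bm _ _ _) (lexx a) sb).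
- by move=> s /=; rewrite in_itv/= => /andP[as_ sb];
  apply: (bm_integrable bphi (lexx a) sb).
- by move=> s /=; rewrite in_itv/= => /andP[as_ sb]; exact: weight_forward.
- have [B [_ hB]] := bounded_by_weight (2 * K) bphi.
  by exists B => s /=; rewrite in_itv/= => /hB; apply: le_trans; exact: ler_norm.
- by move=> s /=; rewrite in_itv/= mul0r add0r; exact: phiP.
Qed.

End Gronwall.

(** * Backward integral equations: stability and comparison *)

Section TailEquation.
Context {R : realType}.
Implicit Types (F : R -> R -> R) (U V g h : R -> R) (s t K T e : R).

Notation mu := (@lebesgue_measure R).

Lemma ae_imply (P Q : R -> Prop) : (forall s, P s -> Q s) ->
  {ae mu, forall s, P s} -> {ae mu, forall s, Q s}.
Proof. by move=> PQ; exact: (@filterS _ _ (ae_filter_ringOfSetsType mu) _ _ PQ). Qed.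

(** The first clause is how the Caratheodory property of a generator is used: it
may be composed with bounded measurable processes. *)
Definition lipschitz_generator T K F :=
  (forall U, bounded_measurable `[0, T] U ->
     bounded_measurable `[0, T] (fun s => F s (U s))) /\
  (forall s u u', 0 <= s <= T -> `|F s u - F s u'| <= K * `|u - u'|).

(** [U] solves the backward equation with generator [F] when it is the tail
primitive of [fun s => F s (U s)]. Keeping the integrand as a separate argument
allows sub- and supersolutions to be compared with solutions. *)
Definition tail_primitive T g U :=
  forall t, 0 <= t <= T -> U t = \int[mu]_(s in `[t, T]) g s.

Lemma tail_primitive_bm T g U : 0 <= T -> bounded_measurable `[0, T] g ->
  tail_primitive T g U -> bounded_measurable `[0, T] U.
Proof.
move=> T0 bg gU; apply: eq_bm (tail_integral_bm T0 (bm_integrable bg (lexx _) (lexx _))).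
by move=> t; rewrite inE/= in_itv/= => /gU.
Qed.

Lemma tail_primitive_cat T g U a b : bounded_measurable `[0, T] g ->
  tail_primitive T g U -> 0 <= a -> a <= b -> b <= T ->
  U a = \int[mu]_(s in `[a, b]) g s + U b.
Proof.
move=> bg gU a0 ab bT.
rewrite !gU ?a0 ?bT ?(le_trans a0 ab) ?(le_trans ab bT)//.
by apply: Rintegral_itv_cat; [exact: bmW bg|rewrite ab].
Qed.

Lemma tail_primitive_lincomb T a b g h U V : bounded_measurable `[0, T] g ->
  bounded_measurable `[0, T] h -> tail_primitive T g U -> tail_primitive T h V ->
  tail_primitive T (fun s => a * g s + b * h s) (fun s => a * U s + b * V s).
Proof.
move=> bg bh gU hV t /[dup] tT /andP[t0 _]; rewrite gU// hV//.
have W k : bounded_measurable `[0, T] k -> bounded_measurable `[t, T] k by exact: bmW.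
rewrite RintegralD_itv; [|exact: bmZ (W _ _)..].
by rewrite !RintegralZ_itv//; exact: W.
Qed.

(** The end point is Lebesgue-null: what happens at time [T] is invisible to the
utility process. *)
Lemma tail_primitive_eq_end T g h U : bounded_measurable `[0, T] g ->
  bounded_measurable `[0, T] h -> (forall s, 0 <= s < T -> g s = h s) ->
  tail_primitive T g U -> tail_primitive T h U.
Proof.
move=> bg bh gh gU t /[dup] tT /andP[t0 tT']; rewrite gU//.
have W k : bounded_measurable `[0, T] k ->
    mu.-integrable [set` Interval (BLeft t) (BLeft T)] (EFin \o k).
  move=> bk; apply: integrableS (bm_integrable bk t0 (lexx T)) => //.
  by apply: subset_itvl; rewrite bnd_simp.
rewrite -(Rintegral_itv_bndo_bndc (W _ bg)) -(Rintegral_itv_bndo_bndc (W _ bh)).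
apply: eq_Rintegral => s; rewrite inE/= in_itv/= => /andP[ts sT].
by rewrite gh// (le_trans t0 ts).
Qed.

(** A process [V] driven by [g] solves the equation up to the defect [F s (V s)
- g s]; by Gronwall its distance to the solution is controlled by the integral
of the defect. This one estimate gives the a priori bound ([V] and [g] null) and
the stability of solutions. *)
Lemma tail_solution_dist T K F U V g : 0 <= T -> 0 < K ->
  lipschitz_generator T K F ->
  bounded_measurable `[0, T] U -> tail_primitive T (fun s => F s (U s)) U ->
  bounded_measurable `[0, T] g -> tail_primitive T g V ->
  forall t, 0 <= t <= T -> `|U t - V t| <=
    2 * \int[mu]_(s in `[0, T]) `|F s (V s) - g s| * expR (2 * K * T).
Proof.
move=> T0 K0 [bF lF] bU FU bg gV t t0T.
have bV := tail_primitive_bm T0 bg gV.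
have bFV := bF _ bV; have bFU := bF _ bU.
have bh := bm_norm (bmB bFV bg); have bd := bm_norm (bmB bU bV).
rewrite -{2}(subr0 T).
apply: (gronwall_backward K0 _ bd _ t0T).
  by apply: Rintegral_ge0.
move=> s /[dup] sT /andP[s0 sT'].
have W h : bounded_measurable `[0, T] h -> bounded_measurable `[s, T] h by exact: bmW.
rewrite FU// gV// -RintegralB_itv; [|exact: W..].
apply: (le_trans (le_norm_Rintegral_itv (W _ (bmB bFU bg)))).
apply: (@le_trans _ _ (\int[mu]_(x in `[s, T]) (`|F x (V x) - g x| + K * `|U x - V x|))).
  apply: le_Rintegral_itv.
  - exact: W (bm_norm (bmB bFU bg)).
  - exact: W (bmD bh (bmZ K bd)).
  move=> x /andP[sx xT]; rewrite -(subrKA (F x (V x))) addrC.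
  by rewrite (le_trans (ler_normD _ _))// lerD2l lF// xT (le_trans s0).
rewrite RintegralD_itv; [|exact: W bh|exact: W (bmZ K bd)].
rewrite RintegralZ_itv; last exact: W.
rewrite lerD2r (@Rintegral_itv_cat _ 0 s T)//.
by rewrite lerDr Rintegral_ge0.
Qed.

Lemma ae_eq0_Rintegral_itv a b h : bounded_measurable `[a, b] h ->
  (forall s, a <= s <= b -> 0 <= h s) -> \int[mu]_(s in `[a, b]) h s = 0 ->
  {ae mu, forall s, a <= s <= b -> h s = 0}.
Proof.
move=> bh h0 I0; have mE : measurable_fun `[a, b] (EFin \o h).
  by apply/measurable_EFinP; exact: bh.1.
have ih := bm_integrable bh (lexx a) (lexx b).
have : (\int[mu]_(s in `[a, b]) `|(EFin \o h) s| = 0)%E.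
  transitivity (\int[mu]_(s in `[a, b]) (h s)%:E)%E.
    apply: eq_integral => s; rewrite inE/= in_itv/= => /h0 hs.
    by rewrite ger0_norm.
  have mab : measurable (`[a, b]%classic : set (measurableTypeR R))
    by exact: measurable_itv.
  have fin := integrable_fin_num mab ih.
  by rewrite -(fineK fin); congr (_%:E).
move=> /(ae_eq_integral_abs mu (measurable_itv _) mE).
apply: filterS => s hs sab; have := hs _; rewrite /= in_itv/= => /(_ sab) /=.
by move=> [].
Qed.

(** Suppose [D = V - U] is positive at [t0], and let [t1] be the first later
time where it is not; there [D] vanishes. On [t0, t1] the Lipschitz bound may be
used with the sign of [D], so [D t <= K * int_t^t1 D], and Gronwall gives [D t0
<= 0]. *)
Lemma tail_comparison T K F U V g : 0 <= T -> 0 < K ->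
  lipschitz_generator T K F ->
  bounded_measurable `[0, T] U -> tail_primitive T (fun s => F s (U s)) U ->
  bounded_measurable `[0, T] g -> tail_primitive T g V ->
  (forall s, 0 <= s <= T -> g s <= F s (V s)) ->
  forall t, 0 <= t <= T -> V t <= U t.
Proof.
move=> T0 K0 [bF lF] bU FU bg gV gF t0 /andP[t00 t0T]; rewrite leNgt;
  apply/negP => UV.
have bV := tail_primitive_bm T0 bg gV.
have bFV := bF _ bV; have bFU := bF _ bU.
pose D s := V s - U s; pose d s := g s - F s (U s).
have bd : bounded_measurable `[0, T] d by exact: bmB.
have bD : bounded_measurable `[0, T] D by exact: bmB.
have dD : tail_primitive T d D.
  move=> t /[dup] tT /andP[t_0 t_T]; by rewrite /D FU// gV// -RintegralB_itv//;
    [exact: (bmW t_0 _ bg)|exact: (bmW t_0 _ bFU)].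
have D0 : 0 < D t0 by rewrite subr_gt0.
have [B B0 dB] : exists2 B, 0 < B & forall s, 0 <= s <= T -> `|d s| <= B.
  have [_ [B dB]] := bd; exists (`|B| + 1); first by rewrite ltr_wpDl.
  move=> s sT; rewrite (le_trans (dB s _)) /= ?in_itv//.
  by rewrite (le_trans (ler_norm _))// lerDl.
have Dlip a b : 0 <= a -> a <= b -> b <= T -> `|D a - D b| <= B * (b - a).
  move=> a0 ab bT; rewrite (tail_primitive_cat bd dD a0 ab bT) addrK.
  apply: Rintegral_itv_bound => //; first exact: bmW bd.
  by move=> s /andP[as_ sb]; rewrite dB// (le_trans a0)// (le_trans sb).
pose S := [set t | t0 <= t <= T /\ D t <= 0].
have ST : S T.
  by split; [rewrite t0T lexx|rewrite dD ?T0 ?lexx// set_itv1 Rintegral_set1].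
have infS : has_inf S by split; [exists T|exists t0 => s [/andP[]]].
pose t1 := inf S.
have t01 : t0 <= t1 by apply: lb_le_inf; [exists T|move=> s [/andP[]]].
have t1T : t1 <= T by apply: inf_lbound => //; case: infS.
have t10 : 0 <= t1 by exact: le_trans t01.
have Dpos s : t0 <= s < t1 -> 0 < D s.
  move=> /andP[t0s st1]; rewrite ltNge; apply/negP => Ds.
  have : t1 <= s by apply: inf_lbound; [case: infS|split => //;
    rewrite t0s (le_trans (ltW st1))].
  by rewrite leNgt st1.
have D1 : D t1 <= 0.
  apply/ler_addgt0Pr => e e0; rewrite add0r.
  have [|s Ss st] := @inf_adherent _ S (e / B) _ infS; first by rewrite divr_gt0.
  have [/andP[t0s sT] Ds] := Ss.
  have t1s : t1 <= s by apply: inf_lbound => //; case: infS.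
  have := Dlip _ _ t10 t1s sT => /(le_trans (ler_norm _)) h.
  have : B * (s - t1) <= e.
    by rewrite mulrC -ler_pdivlMr// lerBlDl ltW.
  by move: h Ds; lra.
have lt01 : t0 < t1.
  rewrite lt_neqAle t01 andbT; apply/eqP => E; move: D1; rewrite -E.
  by rewrite leNgt D0.
(* Not only D t1 <= 0: the increment of D over [t, t1] must be all of D t. *)
have D1' : D t1 = 0.
  apply/eqP; rewrite eq_le D1/=; apply/ler_addgt0Pr => e e0.
  pose s := Num.max t0 (t1 - e / B).
  have st : t0 <= s < t1.
    by rewrite /s le_max lexx/= gt_max lt01/= gtrBl divr_gt0.
  have /andP[t0s st1] := st.
  have := Dlip _ _ (le_trans t00 t0s) (ltW st1) t1T => /(le_trans (ler_norm _)) h.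
  have : B * (t1 - s) <= e.
    by rewrite mulrC -ler_pdivlMr// lerBlDl -lerBlDr /s le_max lexx orbT.
  by have := Dpos _ st; move: h; lra.
pose phi s := `|D s|.
have bphi : bounded_measurable `[t0, t1] phi.
  by apply: bm_norm; exact: bmW bD.
have := @gronwall_backward _ t0 t1 K 0 phi K0 (lexx _) bphi _ t0.
rewrite mulr0 mul0r lexx t01 => /(_ _ isT)/wrap[]; last first.
  by rewrite /phi normr_le0 => /eqP DE; rewrite DE ltxx in D0.
move=> s /[dup] st /andP[t0s st1]; rewrite add0r.
have s0 := le_trans t00 t0s.
have -> : phi s = \int[mu]_(x in `[s, t1]) d x.
  rewrite /phi (tail_primitive_cat bd dD s0 st1 t1T) D1' addr0 ger0_norm//.
  have := tail_primitive_cat bd dD s0 st1 t1T; rewrite D1' addr0 => <-.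
  by move: st1; rewrite le_eqVlt => /predU1P[->|st1]; [rewrite D1'|apply/ltW/Dpos;
    rewrite t0s].
have W h : bounded_measurable `[0, T] h -> bounded_measurable `[s, t1] h
  by exact: bmW.
rewrite -RintegralZ_itv; last exact: W (bm_norm bD).
apply: le_Rintegral_itv; [exact: W|exact: W (bmZ K (bm_norm bD))|].
move=> x /andP[sx xt]; have xT : 0 <= x <= T
  by rewrite (le_trans s0)//= (le_trans xt).
apply: (le_trans _ (lF _ _ _ xT)); apply: le_trans (ler_norm _).
by rewrite /d lerD2r gF.
Qed.

(** The nonnegative process [U - V] vanishes at 0 and grows at rate at most [K *
(U - V)], so it vanishes identically by the forward Gronwall inequality. The
integrands then have equal integrals and are ordered. *)
Lemma tail_comparison_eq T K F U V g : 0 <= T -> 0 < K ->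
  lipschitz_generator T K F ->
  bounded_measurable `[0, T] U -> tail_primitive T (fun s => F s (U s)) U ->
  bounded_measurable `[0, T] g -> tail_primitive T g V ->
  (forall s, 0 <= s <= T -> g s <= F s (V s)) -> U 0 <= V 0 ->
  {ae mu, forall s, 0 <= s <= T -> g s = F s (V s)}.
Proof.
move=> T0 K0 lF bU FU bg gV gF UV0.
have VU := tail_comparison T0 K0 lF bU FU bg gV gF.
have [bF LF] := lF.
have bV := tail_primitive_bm T0 bg gV.
have bFV := bF _ bV; have bFU := bF _ bU.
have U0V : U 0 = V 0 by apply/eqP; rewrite eq_le UV0 VU// lexx.
have bE : bounded_measurable `[0, T] (fun s => U s - V s) by exact: bmB.
have E0 t : 0 <= t <= T -> U t - V t <= 0.
  apply: (gronwall_forward K0 bE) => {}t /[dup] tT /andP[t0 tT'].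
  have h1 := tail_primitive_cat bFU FU (lexx _) t0 tT'.
  have h2 := tail_primitive_cat bg gV (lexx _) t0 tT'.
  have W h : bounded_measurable `[0, T] h -> bounded_measurable `[0, t] h
    by exact: bmW.
  have -> : U t - V t = \int[mu]_(s in `[0, t]) g s - \int[mu]_(s in `[0, t]) F s (U s).
    by lra.
  rewrite -RintegralB_itv; [|exact: W..].
  rewrite -RintegralZ_itv; last exact: W.
  apply: le_Rintegral_itv; [exact: W (bmB bg bFU)|exact: W (bmZ K bE)|].
  move=> s /andP[s0 st]; have sT : 0 <= s <= T by rewrite s0 (le_trans st).
  apply: (@le_trans _ _ (F s (V s) - F s (U s))); first by rewrite lerD2r gF.
  rewrite (le_trans (ler_norm _))// (le_trans (LF _ _ _ sT))//.
  by rewrite distrC ger0_norm// subr_ge0 VU.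
have UV t : 0 <= t <= T -> U t = V t.
  by move=> tT; apply/eqP; rewrite eq_le VU// andbT -subr_le0 E0.
have bh := bmB bFV bg.
suff I0 : \int[mu]_(s in `[0, T]) (F s (V s) - g s) = 0.
  have h0 s : 0 <= s <= T -> 0 <= F s (V s) - g s by move=> sT; rewrite subr_ge0 gF.
  apply: ae_imply (ae_eq0_Rintegral_itv bh h0 I0) => s h sT.
  by apply/esym/eqP; rewrite -subr_eq0 h.
rewrite RintegralB_itv// -(gV 0) ?lexx// -U0V (FU 0) ?lexx//.
apply/eqP; rewrite subr_eq0; apply/eqP; apply: eq_Rintegral => s.
by rewrite inE/= in_itv/= => sT; rewrite UV.
Qed.

End TailEquation.

(** * Backward integral equations: existence and convergence *)

Section TailExistence.
Context {R : realType}.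
Implicit Types (F : R -> R -> R) (U V g h p q : R -> R) (s t K T e c : R).

Notation mu := (@lebesgue_measure R).

(** One Picard step halves distances measured in the exponential weight. *)
Lemma tail_contraction T K F p q e : 0 <= T -> 0 < K ->
  lipschitz_generator T K F ->
  bounded_measurable `[0, T] p -> bounded_measurable `[0, T] q ->
  (forall s, 0 <= s <= T -> `|p s - q s| <= e * expR (- (2 * K) * s)) ->
  forall t, 0 <= t <= T ->
  `|\int[mu]_(s in `[t, T]) F s (p s) - \int[mu]_(s in `[t, T]) F s (q s)|
    <= e / 2 * expR (- (2 * K) * t).
Proof.
move=> T0 K0 [bF lF] bp bq pq t /andP[t0 tT].
have W h : bounded_measurable `[0, T] h -> bounded_measurable `[t, T] h by exact: bmW.
have e0 : 0 <= e.
  have := pq 0; rewrite lexx T0 mulr0 expR0 mulr1 => /(_ isT).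
  exact: le_trans.
rewrite -RintegralB_itv; [|exact: W (bF _ bp)|exact: W (bF _ bq)].
have bd := bmB (bF _ bp) (bF _ bq).
apply: (le_trans (le_norm_Rintegral_itv (W _ bd))).
apply: (@le_trans _ _ (\int[mu]_(s in `[t, T]) (e * K * expR (- (2 * K) * s)))).
  apply: le_Rintegral_itv; [exact: W (bm_norm bd)|exact: bmZ (expR_weight_bm _ _ _)|].
  move=> s /andP[ts sT]; have s0T : 0 <= s <= T by rewrite (le_trans t0).
  by rewrite (le_trans (lF _ _ _ s0T))// [e * K]mulrC -mulrA ler_pM2l// pq.
rewrite RintegralZ_itv; last exact: expR_weight_bm.
by rewrite -!mulrA ler_wpM2l// [leRHS]mulrC weight_backward.
Qed.

Lemma geometric_half_cvg (A : R) : A * 2^-1 ^+ n @[n --> \oo] --> 0.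
Proof. by apply: cvg_geometric; rewrite ger0_norm ?invr_ge0// invf_lt1// ltr1n. Qed.

Lemma eq_of_geometric_dist_le (x y A : R) :
  (forall n, `|x - y| <= A * 2^-1 ^+ n) -> x = y.
Proof.
move=> h; apply/eqP; rewrite -subr_eq0 -normr_le0.
have <- := cvg_lim (@Rhausdorff R) (geometric_half_cvg A).
apply: limr_ge; first by apply/cvg_ex; exists 0; exact: geometric_half_cvg.
exact: nearW.
Qed.

(** Picard iteration from 0. The iterates shifted down (up) by the geometric
remainder [r n] increase (decrease) with [n], so the limit can be defined as the
supremum of the lower shifts, with the error bound [r n] for free. *)
Lemma tail_solution_exists T K F : 0 <= T -> 0 < K -> lipschitz_generator T K F ->
  exists U, bounded_measurable `[0, T] U /\ tail_primitive T (fun s => F s (U s)) U.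
Proof.
move=> T0 K0 lF; have [bF _] := lF.
pose Phi g t := \int[mu]_(s in `[t, T]) F s (g s).
pose u n := iter n Phi (fun=> 0).
pose W t := expR (- (2 * K) * t).
have bPhi g : bounded_measurable `[0, T] g -> bounded_measurable `[0, T] (Phi g).
  by move=> bg; apply: tail_integral_bm => //; apply: (bm_integrable (bF _ bg)).
have bu n : bounded_measurable `[0, T] (u n).
  by elim: n => [|n IH]; [exact: bm_cst|exact: bPhi].
have [c [c0 uc]] := bounded_by_weight (- (2 * K)) (bmB (bu 1%N) (bu 0%N)).
have step n t : 0 <= t <= T -> `|u n.+1 t - u n t| <= c * 2^-1 ^+ n * W t.
  elim: n t => [|n IH] t tT; first by rewrite expr0 mulr1; exact: uc.
  rewrite exprSr [leRHS](_ : _ = (c * 2^-1 ^+ n) / 2 * W t); last by rewrite mulrA.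
  exact: (tail_contraction T0 K0 lF (bu n.+1) (bu n) IH).
(* The sum of all later steps: r n - r n.+1 is the bound on the n-th step. *)
pose r n t := 2 * c * W t * 2^-1 ^+ n.
have W0 t : 0 <= W t by exact: expR_ge0.
have rS n t : r n t - r n.+1 t = c * 2^-1 ^+ n * W t.
  by rewrite /r exprSr; field.
have r0 n t : 0 <= r n t by rewrite /r !mulr_ge0// exprn_ge0// invr_ge0.
have am t : 0 <= t <= T -> {homo (fun n => u n t - r n t) : m n / (m <=
  n)%N >-> m <= n}.
  move=> tT; apply: homo_leq => [//|? ? ?|n]; first exact: le_trans.
  by have := step n t tT; rewrite -rS ler_norml => /andP[h _]; lra.
have bmn t : 0 <= t <= T -> {homo (fun n => u n t + r n t) : m n / (m <=
  n)%N >-> n <= m}.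
  move=> tT; apply: (homo_leq (r := fun x y => y <= x)) => [//|? ? ? /[swap]|n].
    exact: le_trans.
  by have := step n t tT; rewrite -rS ler_norml => /andP[_ h]; lra.
pose U t := sup (range (fun n => u n t - r n t)).
have Uu n t : 0 <= t <= T -> `|U t - u n t| <= r n t.
  move=> tT; have ub m k : u m t - r m t <= u k t + r k t.
    apply: (le_trans (am t tT _ _ (leq_maxl m k))).
    apply: (le_trans _ (bmn t tT _ _ (leq_maxr m k))).
    by rewrite lerD2l (le_trans _ (r0 _ _))// oppr_le0.
  rewrite ler_distlC; apply/andP; split.
    rewrite lerBlDr; apply: ge_sup; first by exists (u 0%N t - r 0%N t), 0%N.
    by move=> _ [m _ <-].
  rewrite -lerBlDr; apply: ub_le_sup; last by exists n.
  by exists (u 0%N t + r 0%N t) => _ [m _ <-].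
have [BW BW0 WB] : exists2 B, 0 <= B & forall t, 0 <= t <= T -> W t <= B.
  have [_ [B hB]] := expR_weight_bm 0 T (- (2 * K)).
  exists `|B| => // t tT; rewrite (le_trans (ler_norm _))//.
  by rewrite (le_trans (hB t _)) ?ler_norm//= in_itv.
have bU : bounded_measurable `[0, T] U.
  split.
    apply: (@measurable_fun_cvg _ _ _ _ u) => [n|t]; first by have [] := bu n.
    rewrite /= in_itv/= => tT; apply/cvgrPdist_le => e e0.
    have /cvgrPdist_le/(_ _ e0) := geometric_half_cvg (2 * c * W t).
    apply: filterS => n; rewrite sub0r normrN => h.
    by rewrite (le_trans (Uu n t tT))// (le_trans (ler_norm _)).
  exists (2 * c * BW) => t; rewrite /= in_itv/= => tT.
  have := Uu 0%N t tT; rewrite /u /= subr0 /r expr0 mulr1 => /le_trans; apply.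
  by rewrite ler_wpM2l ?mulr_ge0// WB.
exists U; split => // t tT.
apply: (@eq_of_geometric_dist_le _ _ (2 * c * W t)) => n.
have h1 := Uu n.+1 t tT.
have h2 := @tail_contraction T K F (u n) U (2 * c * 2^-1 ^+ n) T0 K0 lF (bu n) bU.
have {}h2 := h2 _ t tT.
rewrite -(subrKA (u n.+1 t)) (le_trans (ler_normD _ _))//.
apply: (le_trans (lerD h1 (h2 _))).
  move=> s sT; rewrite distrC (le_trans (Uu n s sT))// /r le_eqVlt.
  by apply/orP; left; apply/eqP; rewrite /W; ring.
by rewrite le_eqVlt /r -/(W t) exprSr; apply/orP; left; apply/eqP; field.
Qed.

(** By the stability estimate it is enough that the defect of the limit solution
[U] in the approximating equations tends to 0 in mean, which is dominated
convergence. *)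
Lemma tail_solution_cvg T K F U (Fn : nat -> R -> R -> R) (Un : nat -> R ->
  R) (B : R) :
  0 <= T -> 0 < K ->
  (forall n, lipschitz_generator T K (Fn n)) -> lipschitz_generator T K F ->
  (forall n, bounded_measurable `[0, T] (Un n)) ->
  (forall n, tail_primitive T (fun s => Fn n s (Un n s)) (Un n)) ->
  bounded_measurable `[0, T] U -> tail_primitive T (fun s => F s (U s)) U ->
  (forall n s, 0 <= s <= T -> `|Fn n s (U s)| <= B) ->
  {ae mu, forall s, 0 <= s <= T -> Fn n s (U s) @[n --> \oo] --> F s (U s)} ->
  Un n 0 @[n --> \oo] --> U 0.
Proof.
move=> T0 K0 lFn lF bUn FUn bU FU FnB aeF.
have bFU := lF.1 _ bU; have bFnU n := (lFn n).1 _ bU.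
pose I n := \int[mu]_(s in `[0, T]) `|Fn n s (U s) - F s (U s)|.
suff I0 : I n @[n --> \oo] --> 0.
  have E0 : 2 * I n * expR (2 * K * T) @[n --> \oo] --> 2 * 0 * expR (2 * K * T).
    by apply: cvgMl; apply: cvgMr.
  rewrite mulr0 mul0r in E0.
  apply/cvgrPdist_le => e e0; have /cvgrPdist_le/(_ _ e0) := E0.
  apply: filterS => n; rewrite sub0r normrN distrC => h.
  have := tail_solution_dist T0 K0 (lFn n) (bUn n) (FUn n) bFU FU (_ : 0 <= 0 <= T).
  rewrite lexx T0 => /(_ isT) /le_trans; apply.
  exact: le_trans (ler_norm _) h.
have mD : measurable (`[0, T]%classic : set (measurableTypeR R))
  by exact: measurable_itv.
have [|||||_ + _] := @dominated_convergence _ _ R mu `[0, T]%classic mD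
  (fun n s => (Fn n s (U s))%:E) (fun s => (F s (U s))%:E) (cst B%:E).
- by move=> n; apply/measurable_EFinP; have [] := bFnU n.
- by apply/measurable_EFinP; have [] := bFU.
- apply: ae_imply aeF => s h; rewrite /= in_itv/= => sT.
  by apply: cvg_EFin; [exact: nearW|exact: h].
- by apply: (bm_integrable (bm_cst `[0, T] B)).
- apply: aeW => s n; rewrite /= in_itv/= => sT; rewrite lee_fin; exact: FnB.
- exact: (@fine_cvg _ _ _ _ _ 0).
Qed.

End TailExistence.

(** * Composition with the aggregator *)

Section Caratheodory.
Context {R : realType}.
Implicit Types (s t y u e T : R).

(** The first-order expansion at [(y, u)] bounds the increments of [g] by a
multiple of the distance, hence continuity along sequences in [D]. *)
Lemma C1_on_cvg (D : set (R * R)) (g : R -> R -> R) y u (yn un : nat -> R) :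
  C1_on D g -> D (y, u) -> (forall n, D (yn n, un n)) ->
  yn n @[n --> \oo] --> y -> un n @[n --> \oo] --> u ->
  g (yn n) (un n) @[n --> \oo] --> g y u.
Proof.
move=> [g1 [g2 [_ _ dg]]] Dz Dzn yny unu.
pose z : R * R := (y, u); pose zn n : R * R := (yn n, un n).
have znz : zn n @[n --> \oo] --> z by apply: (cvg_pair yny unu).
have := dg z Dz 1 ltr01; rewrite near_withinE => gz.
pose L := `|g1 z| + `|g2 z| + 1.
have bound : \forall n \near \oo, `|g (yn n) (un n) - g y u| <= L * `|zn n - z|.
  have : \forall n \near \oo, D (zn n) ->
      `|g (zn n).1 (zn n).2 - g z.1 z.2 - (g1 z * ((zn n).1 - z.1) + g2 z * ((zn n).2 - z.2))|
        <= 1 * `|zn n - z| by exact: znz gz.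
  apply: filterS => n /(_ (Dzn n)) /=; rewrite mul1r => h.
  have n1 : `|yn n - y| <= `|zn n - z| by rewrite [leRHS]prod_normE/= le_max lexx.
  have n2 : `|un n - u| <= `|zn n - z|
    by rewrite [leRHS]prod_normE/= le_max lexx orbT.
  rewrite -[X in `|X|](subrK (g1 z * (yn n - y) + g2 z * (un n - u))).
  rewrite (le_trans (ler_normD _ _))// /L mulrDl mul1r addrC lerD//.
  rewrite (le_trans (ler_normD _ _))// mulrDl !normrM lerD// ler_wpM2l//.
have d0 : L * `|zn n - z| @[n --> \oo] --> 0.
  rewrite -(mulr0 L); apply: cvgMr; rewrite -(@normr0 R (R * R)%type) -(subrr z).
  by apply: cvg_norm; apply: cvgB => //; exact: cvg_cst.
apply/cvgrPdist_le => e e0; move/cvgrPdist_le: d0 => /(_ _ e0) d0.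
near=> n; rewrite distrC.
have h1 : `|g (yn n) (un n) - g y u| <= L * `|zn n - z| by near: n.
have h2 : `|0 - L * `|zn n - z| | <= e by near: n.
by rewrite (le_trans h1)// (le_trans _ h2)// sub0r normrN ler_norm.
Unshelve. all: by end_near. Qed.

Definition round_down (n : nat) (x : R) : R :=
  (Num.floor (n.+1%:R * x))%:~R / n.+1%:R.

Lemma round_down_itv n x : round_down n x <= x < round_down n x + n.+1%:R^-1.
Proof.
have n0 : 0 < n.+1%:R :> R by rewrite ltr0n.
have /andP[h1 h2] := floor_itv (n.+1%:R * x).
rewrite /round_down ler_pdivrMr// [x * _]mulrC h1 -[X in _ + X]mul1r -mulrDl ltr_pdivlMr//.
by rewrite [x * _]mulrC (lt_le_trans h2)// intrD.
Qed.

Lemma round_down_cvg x : round_down n x @[n --> \oo] --> x.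
Proof.
apply/cvgrPdist_lt => e e0.
near=> n; have /andP[h1 h2] := round_down_itv n x.
rewrite ger0_norm ?subr_ge0//.
have : n.+1%:R^-1 < e by near: n; exact: near_infty_natSinv_lt (PosNum e0).
by rewrite ltrBlDl => ne; apply: (lt_trans h2); rewrite ltrD2l.
Unshelve. all: by end_near. Qed.

Lemma round_down_ge0 n x : 0 <= x -> 0 <= round_down n x.
Proof.
by move=> x0; rewrite divr_ge0// ler0z floor_ge0 mulr_ge0.
Qed.

Lemma measurable_level (D : set R) (h : R -> R) n (i : int) : measurable D ->
  measurable_fun D h ->
  measurable (D `&` [set s | Num.floor (n.+1%:R * h s) = i]).
Proof.
move=> mD mh; have mh' : measurable_fun D (fun s => n.+1%:R * h s).
  exact: measurable_funM.
have -> : D `&` [set s | Num.floor (n.+1%:R * h s) = i] =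
    D `&` (fun s => n.+1%:R * h s) @^-1` `[i%:~R, (i + 1)%:~R[%classic.
  apply/seteqP; split => s [Ds] /=.
    by move=> <-; split => //; rewrite in_itv/= floor_itv.
  by rewrite in_itv/= => hs; split => //; exact: floor_def.
exact: mh'.
Qed.

(** Rounding [Y] and [U] down to multiples of 1 / n.+1 gives countably many
measurable pieces on each of which the rounded arguments are constant.
Continuity in the last two arguments allows [n] to tend to infinity. Rounding
down keeps the second argument nonnegative, where the assumptions on [f] hold.
*)
Lemma caratheodory_measurable (D : set R) (f : R -> R -> R -> R) (Y U : R -> R) :
  measurable D ->
  (forall y u, 0 <= y -> measurable_fun D (fun s => f s y u)) ->
  (forall s, D s -> C1_on (@half_plane R) (f s)) ->
  measurable_fun D Y -> measurable_fun D U -> (forall s, D s -> 0 <= Y s) ->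
  measurable_fun D (fun s => f s (Y s) (U s)).
Proof.
move=> mD mf C1f mY mU Y0.
apply: (@measurable_fun_cvg _ _ _ _
  (fun n s => f s (round_down n (Y s)) (round_down n (U s)))); last first.
  move=> s Ds; apply: (C1_on_cvg (C1f s Ds)).
  - exact: Y0.
  - by move=> n; exact/round_down_ge0/Y0.
  - exact: round_down_cvg.
  - exact: round_down_cvg.
move=> n _ B mB.
pose A (ij : nat * int) := (D `&` [set s | Num.floor (n.+1%:R * Y s) = ij.1%:Z]) `&`
  (D `&` [set s | Num.floor (n.+1%:R * U s) = ij.2]) `&`
  (D `&` (fun s => f s (ij.1%:R / n.+1%:R) (ij.2%:~R / n.+1%:R)) @^-1` B).
have -> : D `&` (fun s => f s (round_down n (Y s)) (round_down n (U s))) @^-1` B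
    = \bigcup_ij A ij.
  apply/seteqP; split => s.
    move=> [Ds /= Bs].
    have : (0 <= Num.floor (n.+1%:R * Y s))%R by rewrite floor_ge0 mulr_ge0// Y0.
    case E : (Num.floor (n.+1%:R * Y s)) => [i|//] _.
    exists (i, Num.floor (n.+1%:R * U s)) => //; rewrite /A/=.
    split; first by split; split.
    by split => //=; move: Bs; rewrite /round_down E.
  move=> [[i j] _] [[[Ds /= Yi] [_ Uj]] [_ /= Bs]]; split => //=.
  by rewrite /round_down Yi Uj.
apply: countable_bigcupT_measurable; first exact: countableP.
move=> [i j]; apply: measurableI; first apply: measurableI.
- exact: measurable_level.
- exact: measurable_level.
- by apply: mf => //; rewrite divr_ge0.
Qed.

Lemma aggregator_bounded T f : aggregator T f -> forall B, exists M,
  forall s y u, 0 <= s <= T -> 0 <= y <= B -> `|u| <= B -> `|f s y u| <= M.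
Proof.
case=> _ _ _ _ [L L0 lf] [alpha [K [/andP[a0 _] K0 gf]]] B.
exists (K * (1 + B `^ alpha) + L * B) => s y u sT /andP[y0 yB] uB.
have sT' : s \in `[0, T] by rewrite in_itv.
rewrite -[f s y u](subrK (f s y 0)) (le_trans (ler_normD _ _))// addrC lerD//.
  rewrite (le_trans (gf _ _ sT' y0))// ler_pM2l// lerD2l ger0_norm//.
  by apply: ge0_ler_powR; rewrite ?nnegrE//; [exact: ltW|exact: le_trans yB].
by rewrite (le_trans (lf _ _ _ _ sT' y0))// subr0 ler_pM2l.
Qed.

(** The Lipschitz constant is that of [f], the same for all [Y]. *)
Lemma aggregator_generator T f : aggregator T f ->
  exists2 K, 0 < K & forall Y, bounded_measurable `[0, T] Y ->
    (forall s, 0 <= s <= T -> 0 <= Y s) ->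
    lipschitz_generator T K (fun s u => f s (Y s) u).
Proof.
move=> af; have [mf _ C1f _ [K K0 lf] _] := af; exists K => // Y [mY [BY hY]] Y0.
split=> [U [mU [BU hU]]|s u u' sT]; last by apply: lf; rewrite ?in_itv ?Y0.
split; first exact: (@caratheodory_measurable `[0, T]%classic f).
have [M fM] := aggregator_bounded af (Num.max BY BU).
exists M => s sT; have := sT; rewrite /= in_itv/= => sT'.
apply: fM => //.
  by rewrite Y0// le_max (le_trans (ler_norm _) (hY _ sT)).
by rewrite le_max (hU _ sT) orbT.
Qed.

End Caratheodory.

(** * The level of satisfaction *)

Section Satisfaction.
Context {R : realType}.
Implicit Types (s t e : R) (C : cumulative R R).

Notation mu := (@lebesgue_measure R).
Notation ls := lebesgue_stieltjes_measure.

Lemma within_continuous_dist (A : set R) (g : R -> R) :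
  (forall x, A x -> forall e, 0 < e -> exists2 d : R, 0 < d &
     forall y, A y -> `|x - y| < d -> `|g x - g y| < e) ->
  {within A, continuous g}.
Proof.
move=> h; apply/subspace_continuousP => x Ax; apply/cvgrPdist_lt => e e0.
have [d d0 dP] := h x Ax e e0.
rewrite near_withinE; apply/nbhs_ballP; exists d => //= y; rewrite /ball/= => xy Ay.
exact: dP.
Qed.

Variables (T : R) (eta : R -> R) (theta : R -> R -> R).
Hypothesis eta_continuous : {within `[0, T], continuous eta}.
Hypothesis eta_ge0 : forall t, t \in `[0, T] -> 0 <= eta t.
Hypothesis theta_continuous : {within `[0, T] `*` `[0, T],
  continuous (fun p : R * R => theta p.1 p.2)}.
Hypothesis theta_ge0 : forall t s, t \in `[0, T] -> s \in `[0, T] -> 0 <= theta t s.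

Notation Y := (satisfaction eta theta).

Lemma theta_unif_continuous e : 0 < e -> exists2 d : R, 0 < d &
  forall t t' s s', 0 <= t <= T -> 0 <= t' <= T -> 0 <= s <= T -> 0 <= s' <= T ->
    `|t - t'| < d -> `|s - s'| < d -> `|theta t s - theta t' s'| < e.
Proof.
move=> e0; have cT := @segment_compact R 0 T.
have [d d0 dP] := compact_unif_continuous (compact_setX cT cT) theta_continuous e0.
exists d => // t t' s s' tT tT' sT sT' tt' ss'.
have := dP (t, s) (t', s'); rewrite /= !in_itv/=; apply => //.
Qed.

Lemma theta_slice_continuous t : 0 <= t <= T ->
  {within `[0, t], continuous (theta t)}.
Proof.
move=> /[dup] tT /andP[_ tT']; apply: within_continuous_dist => x.
rewrite /= in_itv/= => /andP[x0 xt] e /theta_unif_continuous[d d0 dP].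
exists d => // y; rewrite in_itv/= => /andP[y0 yt] xy.
apply: dP => //; rewrite ?subrr ?normr0// ?x0 ?y0/=; exact: le_trans tT'.
Qed.

Lemma theta_bounded : exists2 B : R, 0 <= B &
  forall t s, 0 <= t <= T -> 0 <= s <= T -> `|theta t s| <= B.
Proof.
have cT := @segment_compact R 0 T.
have := continuous_compact theta_continuous (compact_setX cT cT).
move=> /compact_bounded[M [Mr MP]].
exists (`|M| + 1); first by rewrite addr_ge0.
move=> t s tT sT; apply: (MP (`|M| + 1)) => /=.
  by rewrite (le_lt_trans (ler_norm M))// ltrDl.
by exists (t, s) => //=; rewrite !in_itv.
Qed.

Lemma satisfaction_ge0 C t : 0 <= t <= T -> 0 <= Y C t.
Proof.
move=> /[dup] tT /andP[t0 tT']; apply: addr_ge0; first by apply: eta_ge0;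
  rewrite in_itv.
apply: Rintegral_ge0 => s; rewrite /= in_itv/= => /andP[s0 st].
have sT : 0 <= (s : R) <= T by rewrite s0 (le_trans st).
by apply: theta_ge0; rewrite in_itv.
Qed.

Lemma satisfaction_bounded M : exists B, forall C, consumption_plans T C ->
  C T <= M -> forall t, 0 <= t <= T -> `|Y C t| <= B.
Proof.
have [E E0 etaE] := continuous_segment_bounded eta_continuous.
have [B B0 thetaB] := theta_bounded.
exists (E + B * M) => C [C0 _] CM t /[dup] tT /andP[t0 tT'].
rewrite (le_trans (ler_normD _ _))// lerD ?etaE//.
apply: (le_trans (stieltjes_cc_bound C0 t0 (theta_slice_continuous tT) _)).
  by move=> s /andP[s0 st]; apply: thetaB => //; rewrite s0 (le_trans st).
by rewrite ler_wpM2l// (le_trans _ CM)// cumulative_is_nondecreasing.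
Qed.

(** The jumps of [C] prevent continuity; instead the integral is a pointwise
limit of Riemann-Stieltjes sums over the partitions [t * (k / n.+1)], whose
terms are products of continuous and monotone functions of [t]. *)
Lemma satisfaction_measurable C : consumption_plans T C ->
  measurable_fun `[0, T] (Y C).
Proof.
move=> [C0 _]; apply: measurable_funD; first by have [] :=
  continuous_bm eta_continuous.
pose p n t k : R := t * (k%:R / n.+1%:R).
have pE n t : p n t n.+1 = t by rewrite /p divff ?mulr1// pnatr_eq0.
have p0 n t : p n t 0%N = 0 by rewrite /p mul0r mulr0.
have nd n t : 0 <= t -> {homo p n t : i j / (i <= j)%N >-> i <= j}.
  by move=> t0 i j ij; rewrite ler_wpM2l// ler_pM2r ?invr_gt0// ler_nat.
apply: (@measurable_fun_cvg _ _ _ _ (fun n t => rs_sum (theta t) C (p n t) n.+1)).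
  move=> n.
  have mC k : measurable_fun `[0, T] (fun t => C (p n t k)).
    have [] // := @nondecreasing_bm R 0 T (fun t => C (p n t k)).
    move=> t t' tt'; apply: (cumulative_is_nondecreasing C).
    by rewrite ler_wpM2r// divr_ge0.
  have mth k : (k <= n.+1)%N -> measurable_fun `[0, T] (fun t => theta t (p n t k)).
    move=> kn; suff cth : {within `[0, T], continuous (fun t => theta t (p n t k))}.
      by have [] := continuous_bm cth.
    have q01 : 0 <= (k%:R / n.+1%:R : R) <= 1.
      by rewrite divr_ge0//= ler_pdivrMr// mul1r ler_nat.
    have pT t : 0 <= t <= T -> 0 <= p n t k <= T.
      move=> /andP[t0 tT]; have /andP[q0 q1] := q01.
      by rewrite mulr_ge0//= (le_trans _ tT)// ler_piMr.
    apply: within_continuous_dist => x;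
      rewrite /= in_itv/= => xT e /theta_unif_continuous[d d0 dP].
    exists d => // y; rewrite in_itv/= => yT xy; apply: dP; rewrite ?pT//.
    have /andP[q0 q1] := q01.
    by rewrite -mulrBl normrM (ger0_norm q0) (le_lt_trans _ xy)// ler_piMr.
  apply: measurable_funD; first exact: measurable_funM (mth _ _) (mC _).
  apply: measurable_sum => k; apply: measurable_funM; first exact: mth.
  exact: measurable_funB.
move=> t; rewrite /= in_itv/= => /[dup] tT /andP[t0 tT'].
apply/cvgrPdist_le => e e0; have Ct0 := cumulative_ge0 C0 t.
have e'0 : 0 < e / (C t + 1) by rewrite divr_gt0// ltr_wpDl.
have [d d0 dP] := theta_unif_continuous e'0.
have : T * n.+1%:R^-1 @[n --> \oo] --> T * 0.
  by apply: cvgMr; apply/cvg_harmonic.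
rewrite mulr0 => /cvgrPdist_lt/(_ _ d0); apply: filterS => n.
rewrite sub0r normrN => /(le_lt_trans (ler_norm _)) Td.
have := @stieltjes_rs_sum _ C (theta t) (p n t) n.+1 (e / (C t + 1)) C0 (nd n t t0).
rewrite pE p0 => /(_ (lexx _) (theta_slice_continuous tT)) h.
apply: le_trans (h _ _) _.
- by move=> x /le_anti <-; rewrite subrr normr0 ltW.
- move=> k kn x /andP[kx xk].
  have pkT : p n t k.+1 <= t by rewrite -[leRHS](pE n); exact: nd.
  have x0 : 0 <= x by rewrite (le_trans _ (ltW kx))// -(p0 n t) nd.
  apply/ltW/dP => //; rewrite ?subrr ?normr0//.
  + by rewrite x0 (le_trans xk)// (le_trans pkT).
  + by rewrite (le_trans x0)//= (le_trans pkT).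
  + rewrite distrC ger0_norm ?subr_ge0//; apply: le_lt_trans Td.
    apply: (@le_trans _ _ (p n t k.+1 - p n t k)); first by rewrite lerD2l lerN2 ltW.
    rewrite /p -mulrBr -mulrBl -natrB// subSnn mul1r ler_wpM2r ?invr_ge0//.
- by rewrite mulrAC ler_pdivrMr ?ltr_wpDl// ler_wpM2l ?ltW// ltrDl.
Qed.

Lemma satisfaction_bm C : consumption_plans T C -> bounded_measurable `[0, T] (Y C).
Proof.
move=> CC; split; first exact: satisfaction_measurable.
have [B hB] := satisfaction_bounded (C T).
by exists B => s; rewrite /= in_itv/= => sT; exact: hB.
Qed.

(** Moving from [t] to [t'] changes the kernel by little, and adds the mass of
dC in between. Hence the level of satisfaction is continuous wherever [C] is,
and right-continuous everywhere. *)
Lemma satisfaction_increment C : consumption_plans T C ->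
  exists2 B : R, 0 <= B & forall e, 0 < e -> exists2 d : R, 0 < d &
  forall t t', 0 <= t <= T -> 0 <= t' <= T -> `|t' - t| < d ->
  `|(Y C t' - eta t') - (Y C t - eta t)| <= e * C T + B * `|C t' - C t|.
Proof.
move=> [C0 _]; have [B B0 hB] := theta_bounded; exists B => // e e0.
have [d d0 dP] := theta_unif_continuous e0; exists d => // t t'.
wlog tt' : t t' / t <= t' => [hw tT t'T td|/andP[t0 tT] /andP[t'0 tT'] ttd].
  have [tt'|/ltW t't] := leP t t'; first exact: hw.
  by rewrite distrC [`|C t' - _|]distrC hw// distrC.
have ndC := cumulative_is_nondecreasing C.
rewrite [in leRHS]ger0_norm ?subr_ge0 ?ndC//.
rewrite /satisfaction ![_ + _ - eta _]addrAC !subrr !add0r.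
have ct' : {within `[0, t'], continuous (theta t')}.
  by apply: theta_slice_continuous; rewrite t'0.
have ct : {within `[0, t], continuous (theta t)}.
  by apply: theta_slice_continuous; rewrite t0.
have ct't : {within `[0, t], continuous (theta t')}.
  by apply: continuous_subspaceW ct'; apply: subset_itvl; rewrite bnd_simp.
rewrite -(subrKA (\int[ls C]_(s in `[0, t]) theta t' s)) addrC.
rewrite (le_trans (ler_normD _ _))// lerD//.
  apply: (@le_trans _ _ (e * C t)).
    apply: stieltjes_dist => // s /andP[s0 st]; apply/ltW/dP;
      rewrite ?subrr ?normr0//.
    - by rewrite t'0.
    - by rewrite t0.
    - by rewrite s0 (le_trans st).
    - by rewrite s0 (le_trans st).
  by apply: ler_wpM2l; [exact: ltW|exact: ndC].
apply: stieltjes_increment => //; first by rewrite t0.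
by move=> s /andP[ts st]; apply: hB;
  rewrite ?t'0// (le_trans t0 (ltW ts)) (le_trans st).
Qed.

Lemma satisfaction_convex C1 C2 C3 a : consumption_plans T C1 ->
  consumption_plans T C2 -> consumption_plans T C3 ->
  (forall s, C3 s = a * C1 s + (1 - a) * C2 s) ->
  forall t, 0 <= t <= T -> Y C3 t = a * Y C1 t + (1 - a) * Y C2 t.
Proof.
move=> [C10 _] [C20 _] [C30 _] C3E t /[dup] tT /andP[t0 _].
rewrite /satisfaction (stieltjes_linear (a := a) (b := 1 - a) C10 C20 C30)//.
  by rewrite 2!mulrDr addrACA -mulrDl [a + _]addrC subrK mul1r.
exact: theta_slice_continuous.
Qed.

End Satisfaction.

(** * Helly selection *)

Section Helly.
Context {R : realType}.
Implicit Types (C : cumulative R R) (a b s t e M : R).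

Notation mu := (@lebesgue_measure R).

(** An interval of positive length is not contained in a null set. *)
Lemma ae_itv_exists (P : R -> Prop) a b : {ae mu, forall t, P t} -> a < b ->
  exists2 t, P t & a < t < b.
Proof.
move=> [N [mN N0 PN]] ab; apply: contrapT => noP.
have sub : `]a, b[%classic `<=` N.
  move=> t; rewrite /= in_itv/= => tab; apply: PN => /= Pt.
  by apply: noP; exists t.
have mab : measurable (`]a, b[%classic : set (measurableTypeR R))
  by exact: measurable_itv.
have := le_measure mu (mem_set mab) (mem_set mN) sub.
rewrite [X in (X <= _)%E](_ : _ = (b - a)%:E); last first.
  by apply: (etrans (lebesgue_measure_itv _)); rewrite /= lte_fin ab.
rewrite [X in (_ <= X)%E]N0 lee_fin; lra.
Qed.

(** A right-continuous function which has a left limit can only fail to be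
continuous by a jump. *)
Lemma discontinuity_of_not_continuous C t : cvg (C x @[x --> t^'-]) ->
  ~ {for t, continuous C} -> discontinuity C t.
Proof.
move=> cl nc; have cr := cumulative_is_right_continuous C t.
split => //; first by apply/cvg_ex; exists (C t).
apply/eqP => E; apply: nc; apply/left_right_continuousP; split => //.
by rewrite -(cvg_lim (@Rhausdorff R) cr) -E.
Qed.

Lemma cumulative_left_cvg C t : cvg (C x @[x --> t^'-]).
Proof.
apply: nondecreasing_at_left_is_cvgr.
  by apply: nearW => x y z _ _; exact: cumulative_is_nondecreasing.
apply: nearW => x; exists (C t) => _ [y /=] /[!in_itv]/= /andP[_ yt] <-.
by apply: cumulative_is_nondecreasing; exact: ltW.
Qed.

Lemma cumulative_ae_continuous C a b :
  {ae mu, forall t, a < t < b -> {for t, continuous C}}.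
Proof.
have cD : countable [set x | x \in (`]a, b[) /\ discontinuity C x].
  by apply: discontinuity_countable => x y _ _; exact: cumulative_is_nondecreasing.
exists [set x | x \in (`]a, b[) /\ discontinuity C x]; split.
- by apply: countable_measurable => //; move=> t; exact: measurable_set1.
- exact: countable_lebesgue_measure0.
- move=> t /= /existsNP[]; rewrite -/(_ -> _) => tab nc; split; first
  by rewrite in_itv.
  by apply: discontinuity_of_not_continuous => //; exact: cumulative_left_cvg.
Qed.

Lemma cumulative_continuity_dense C a b : a < b ->
  exists2 x, {for x, continuous C} & a < x < b.
Proof.
move=> ab; have [t h tab] := ae_itv_exists (cumulative_ae_continuous C a b) ab.
by exists t => //; exact: h.
Qed.

(** The sequence lies in the product of the compact intervals [0, M] over all
real indices, so by Tychonoff it has a cluster point for pointwise convergence.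
A cluster point is not the limit of a subsequence, but it is approximated at any
finite set of points by arbitrarily late members. *)
Lemma nondecreasing_cluster (Cn : nat -> R -> R) M : 0 <= M ->
  (forall n, nondecreasing (Cn n)) -> (forall n t, 0 <= Cn n t <= M) ->
  exists L : R -> R, [/\ nondecreasing L, forall t, 0 <= L t <= M &
    forall (s : nat -> R) k N e, 0 < e -> exists n, (N <= n)%N /\
      forall i, (i < k)%N -> `|Cn n (s i) - L (s i)| < e].
Proof.
move=> M0 ndC CM.
pose X := prod_topology (fun _ : R => R).
pose F : set_system X := [set A | \forall n \near \oo, A (Cn n : X)].
have FF : ProperFilter F.
  split.
  - by rewrite /F/= => -[N _ /(_ N (leqnn N))].
  - split; rewrite /F/=.
    + by exists 0%N.
    + by move=> A B [N1 _ h1] [N2 _ h2]; exists (maxn N1 N2) => // n /=;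
        rewrite geq_max => /andP[n1 n2]; split; [exact: h1|exact: h2].
    + by move=> A B AB [N _ h]; exists N => // n Nn; exact/AB/h.
have [|L [L0M cL]] := @tychonoff R (fun=> R) (fun=> `[0, M]%classic)
    (fun=> @segment_compact R 0 M) F FF.
  exists 0%N => // n _ t; suff : Cn n t \in `[0, M] by [].
  by rewrite in_itv; exact: CM.
have near1 t e : 0 < e -> nbhs (L : X) [set f : X | `|f t - L t| < e].
  move=> e0; have /= := @proj_continuous R (fun=> R) t L [set y | `|y - L t| < e].
  apply; apply/nbhs_ballP; exists e => //= y; rewrite /ball/= distrC //.
have nearn (s : nat -> R) k e : 0 < e ->
    nbhs (L : X) [set f : X | forall i, (i < k)%N -> `|f (s i) - L (s i)| < e].
  move=> e0; elim: k => [|k IH]; first by apply: filterS filterT.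
  apply: filterS (filterI IH (near1 (s k) e e0)) => f [h1 h2] i.
  by rewrite ltnS leq_eqVlt => /predU1P[->//|]; exact: h1.
exists L; split.
- move=> x y xy; apply/ler_addgt0Pr => e e0.
  have e20 : 0 < e / 2 by rewrite divr_gt0.
  have FA : F [set f : X | f x <= f y] by exists 0%N => // n _; exact: ndC.
  have [f [/= fxy [fx fy]]] := cL _ _ FA (filterI (near1 x _ e20) (near1 y _ e20)).
  by move: fx fy; rewrite !ltr_norml => /andP[fx _] /andP[_ fy]; lra.
- by move=> t; have := L0M t; rewrite /= in_itv.
- move=> s k N e e0.
  have FA : F [set f : X | exists2 n, (N <= n)%N & f = Cn n].
    by exists N => // n Nn; exists n.
  by have [f [[n Nn ->] h]] := cL _ _ FA (nearn s k e e0); exists n.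
Qed.

(** Let [L] be a cluster point as above. Choosing the k-th index so that the
first [k] rationals are 1/k-close gives convergence to [L] at every rational.
The limit is the right-continuous regularization [C t = inf_{s > t} L s], and a
continuity point of [C] is squeezed between rationals. The indices [phi k] need
not increase: [k <= phi k] is enough for a maximizing sequence. *)
Lemma helly_selection (Cn : nat -> cumulative R R) M :
  (forall n t, 0 <= Cn n t <= M) ->
  exists (C : cumulative R R) (phi : nat -> nat), (forall k, (k <= phi k)%N) /\
    forall t, {for t, continuous C} -> Cn (phi k) t @[k --> \oo] --> C t.
Proof.
move=> CM; have M0 : 0 <= M by have /andP[h1 h2] := CM 0%N 0; exact: le_trans h2.
have [L [ndL LM Lap]] := nondecreasing_cluster M0
   (fun n => cumulative_is_nondecreasing (Cn n)) CM.
pose q i : R := if unpickle i is Some r then ratr r else 0.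
have /choice[phi phiP] : forall k, exists n, (k <= n)%N /\
    forall i, (i < k)%N -> `|Cn n (q i) - L (q i)| < k.+1%:R^-1.
  by move=> k; apply: Lap; rewrite invr_gt0.
have cvq (r : rat) : Cn (phi k) (ratr r) @[k --> \oo] --> L (ratr r).
  have -> : ratr r = q (pickle r) :> R by rewrite /q pickleK.
  apply/cvgrPdist_lt => e e0; near=> k; rewrite distrC.
  apply: (@lt_trans _ _ k.+1%:R^-1); last by near: k;
    exact: near_infty_natSinv_lt (PosNum e0).
  by apply: (phiP k).2; near: k; exact: nbhs_infty_gt.
pose A t := [set L s | s in `]t, +oo[%classic].
have infA t : has_inf (A t).
  split; first by exists (L (t + 1)), (t + 1) => //=; rewrite in_itv/= andbT ltrDl.
  by exists 0 => _ [s _ <-]; have /andP[] := LM s.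
pose Cf t := inf (A t).
have CL s t : t < s -> Cf t <= L s.
  by move=> ts; apply: inf_lbound; [case: (infA t)|exists s => //=;
    rewrite in_itv/= ts].
have LC t : L t <= Cf t.
  apply: lb_le_inf; first by case: (infA t).
  by move=> _ [s /=] /[!in_itv]/= /andP[ts _] <-; apply: ndL; exact: ltW.
have ndC : nondecreasing Cf.
  move=> x y xy; apply: lb_le_inf; first by case: (infA y).
  by move=> _ [s /=] /[!in_itv]/= /andP[ys _] <-; apply: CL; exact: le_lt_trans ys.
have rcC t e : 0 < e -> exists2 d, 0 < d & Cf (t + d) <= Cf t + e.
  move=> e0; have [_ [s /=] /[!in_itv]/= /andP[ts _] <- Ls] :=
    inf_adherent e0 (infA t).
  exists ((s - t) / 2); first by rewrite divr_gt0// subr_gt0.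
  by apply: le_trans (ltW Ls); apply: CL; lra.
have [C CE] := exists_cumulative ndC (right_continuous_nondecreasing ndC rcC).
exists C, phi; split => [k|t]; first by case: (phiP k).
move=> /cvgrPdist_lt ct; apply/cvgrPdist_le => e e0.
have e20 : 0 < e / 2 by rewrite divr_gt0.
have := ct _ e20 => /nbhs_ballP[d /= d0 dP].
have [|a ha] := @rat_in_itvoo R (t - d / 2) t; first by lra.
have [|b hb] := @rat_in_itvoo R t (t + d / 2); first by lra.
move: ha hb; rewrite !in_itv/= => /andP[a1 a2] /andP[b1 b2].
have La : C t - e / 2 <= L (ratr a).
  have : `|C t - C (t - d / 2)| < e / 2.
    by apply: dP; rewrite /ball/= opprB addrC subrK gtr0_norm ?divr_gt0//; lra.
  have := CL _ _ a1; rewrite -CE ltr_norml => h /andP[_ h']; lra.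
have Lb : L (ratr b) <= C t + e / 2.
  have : `|C t - C (ratr b)| < e / 2.
    by apply: dP; rewrite /ball/= ltr_norml; lra.
  have := LC (ratr b); rewrite -CE ltr_norml => h /andP[h' _]; lra.
have /cvgrPdist_le/(_ _ e20) Ha := cvq a.
have /cvgrPdist_le/(_ _ e20) Hb := cvq b.
near=> k.
have ka : `|L (ratr a) - Cn (phi k) (ratr a)| <= e / 2 by near: k.
have kb : `|L (ratr b) - Cn (phi k) (ratr b)| <= e / 2 by near: k.
have k1 := cumulative_is_nondecreasing (Cn (phi k)) (ratr a) t (ltW a2).
have k2 := cumulative_is_nondecreasing (Cn (phi k)) t (ratr b) (ltW b1).
move: ka kb; rewrite !ler_norml => /andP[_ ka] /andP[kb _].
by apply/andP; split; lra.
Unshelve. all: by end_near. Qed.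

(** Vanishing before 0 and constancy after T pass to the limit along a dense set
of continuity points. In particular [T] need not be a continuity point: all [Cn
n] agree at [T] and at a continuity point to its right. *)
Lemma consumption_plans_closed (T : R) (Cn : nat -> cumulative R R) C : 0 <= T ->
  (forall n, consumption_plans T (Cn n)) ->
  (forall t, {for t, continuous C} -> Cn n t @[n --> \oo] --> C t) ->
  consumption_plans T C /\ Cn n T @[n --> \oo] --> C T.
Proof.
move=> T0 CnT cvC; have ndC := cumulative_is_nondecreasing C.
have ltrDl1 (x : R) : x < x + 1 by rewrite ltrDl.
have ltrBl1 (x : R) : x - 1 < x by rewrite gtrBl.
have left0 s : {for s, continuous C} -> s < 0 -> C s = 0.
  move=> /cvC cs s0; have E : (fun n => Cn n s) = (fun=> 0).
    by apply/funext => n; rewrite (CnT n).1.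
  by rewrite E in cs; exact: (cvg_unique (@Rhausdorff R) cs (cvg_cst 0)).
have right_T s : {for s, continuous C} -> T < s -> Cn n T @[n --> \oo] --> C s.
  move=> /cvC cs Ts; have E : (fun n => Cn n s) = (fun n => Cn n T).
    by apply/funext => n; rewrite (CnT n).2.
  by rewrite E in cs.
have [s1 c1 /andP[Ts1 _]] := @cumulative_continuity_dense C T (T + 1) (ltrDl1 _).
have cT t : T < t -> C t = C s1.
  move=> Tt.
  have [s2 c2 /andP[Ts2 s2t]] := cumulative_continuity_dense C Tt.
  have [s3 c3 /andP[ts3 _]] := @cumulative_continuity_dense C t (t + 1) (ltrDl1 _).
  have E2 : C s2 = C s1 :=
    cvg_unique (@Rhausdorff R) (right_T _ c2 Ts2) (right_T _ c1 Ts1).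
  have E3 : C s3 = C s1 :=
    cvg_unique (@Rhausdorff R) (right_T _ c3 (lt_trans Tt ts3)) (right_T _ c1 Ts1).
  by apply/eqP; rewrite eq_le -{1}E3 -{1}E2 !ndC// ltW.
have CT : C T = C s1.
  have CTs1 : C T <= C s1 by apply: ndC; exact: ltW.
  apply/eqP; rewrite eq_le CTs1/=.
  suff : (C s1 : R) <= (C T : R) by [].
  apply/ler_addgt0Pr => e e0; have [d d0 Cd] := cumulative_right_lt C T e0.
  by rewrite -(cT (T + d)) ?ltrDl.
split; last by rewrite CT; exact: right_T.
split=> [t t0|t Tt]; last by rewrite cT.
have [s2 c2 /andP[_ s2t]] := @cumulative_continuity_dense C (t - 1) t (ltrBl1 _).
have [s3 c3 /andP[ts3 s30]] := cumulative_continuity_dense C t0.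
by apply/eqP; rewrite eq_le -{1}(left0 _ c3 s30) -(left0 _ c2 (lt_trans s2t t0)) !ndC// ltW.
Qed.

End Helly.

(** * The utility maximization problem *)

Section Plans.
Context {R : realType}.
Implicit Types (C : cumulative R R) (a b c t e : R).

Lemma exists_cumulative_lincomb C1 C2 a b :
  nondecreasing (fun s => a * C1 s + b * C2 s) ->
  exists C, forall s, C s = a * C1 s + b * C2 s.
Proof.
move=> nd; apply: (exists_cumulative nd) => t.
by apply: cvgD; apply: cvgMr; exact: cumulative_is_right_continuous.
Qed.

Lemma exists_step a c : 0 <= c ->
  exists C, forall s, C s = if s < a then 0 else c.
Proof.
move=> c0; pose F (s : R) : R := if s < a then 0 else c.
have ndF : nondecreasing F.
  move=> x y xy; rewrite /F; case: ifPn => [xa|]; first by case: ifP.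
  by rewrite -leNgt => ax; rewrite ltNge (le_trans ax xy).
apply: (exists_cumulative ndF); apply: right_continuous_nondecreasing => // t e e0.
have [ta|at_] := ltP t a.
  exists ((a - t) / 2); first by rewrite divr_gt0// subr_gt0.
  rewrite /F (_ : t + (a - t) / 2 < a); last by lra.
  by rewrite ta add0r ltW.
exists 1 => //; rewrite /F [t < a]ltNge at_/= ltNge (le_trans at_) ?lerDl//=.
exact: ltW.
Qed.

Lemma consumption_plans_le (T : R) C t : consumption_plans T C -> C t <= C T.
Proof.
move=> [_ CT]; have [tT|/CT -> //] := leP t T.
exact: cumulative_is_nondecreasing.
Qed.

Lemma consumption_plans_step (T a c : R) C : 0 <= a <= T ->
  (forall s, C s = if s < a then 0 else c) -> consumption_plans T C.
Proof.
move=> /andP[a0 aT] CE; split => t ht; first by rewrite CE (lt_le_trans ht a0).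
by rewrite (CE t) (CE T) !ltNge (ltW (le_lt_trans aT ht)) aT.
Qed.

End Plans.

Section Problem.
Context {R : realType}.
Variables (T w : R) (psi eta : R -> R) (theta : R -> R -> R) (f : R -> R -> R -> R).
Hypothesis T_gt0 : 0 < T.
Hypothesis w_gt0 : 0 < w.
Hypothesis psi_continuous : {within `[0, T], continuous psi}.
Hypothesis psi_gt0 : forall t, t \in `[0, T] -> 0 < psi t.
Hypothesis eta_continuous : {within `[0, T], continuous eta}.
Hypothesis eta_ge0 : forall t, t \in `[0, T] -> 0 <= eta t.
Hypothesis theta_continuous : {within `[0, T] `*` `[0, T],
  continuous (fun p : R * R => theta p.1 p.2)}.
Hypothesis theta_ge0 : forall t s, t \in `[0, T] -> s \in `[0, T] -> 0 <= theta t s.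
Hypothesis f_aggregator : aggregator T f.

Implicit Types (C : cumulative R R) (s t e : R) (U V g : R -> R).

Notation mu := (@lebesgue_measure R).
Notation ls := lebesgue_stieltjes_measure.
Notation Y := (satisfaction eta theta).
Notation RU := (recursive_utility T f eta theta).

Let T0 : 0 <= T := ltW T_gt0.
Let Y_bm C := satisfaction_bm eta_continuous theta_continuous (C := C).
Let Y_ge0 C t := satisfaction_ge0 eta_ge0 theta_ge0 C (t := t).
Let theta_slice := theta_slice_continuous theta_continuous.

Lemma budget_setP C : budget_set T psi w C <->
  consumption_plans T C /\ \int[ls C]_(t in `[0, T]) psi t <= w.
Proof.
split=> -[CC CB]; split => //.
  have ip := continuous_stieltjes_integrable CC.1 T0 psi_continuous.
  have mT : measurable (`[0, T]%classic : set (measurableTypeR R))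
    by exact: measurable_itv.
  have fin := integrable_fin_num mT ip.
  by rewrite -lee_fin /Rintegral fineK.
have ip := continuous_stieltjes_integrable CC.1 T0 psi_continuous.
have mT : measurable (`[0, T]%classic : set (measurableTypeR R))
  by exact: measurable_itv.
have fin := integrable_fin_num mT ip.
by move: CB; rewrite -lee_fin /Rintegral fineK.
Qed.

(** A continuous positive price is bounded below by a positive constant. *)
Lemma budget_total_bounded : exists2 M, 0 <= M &
  forall C, budget_set T psi w C -> C T <= M.
Proof.
have [c cT cmin] := EVT_min T0 psi_continuous.
have c0 := psi_gt0 cT; exists (w / psi c); first by rewrite divr_ge0// ltW.
move=> C /budget_setP[CC CB]; rewrite ler_pdivlMr// mulrC; apply: le_trans CB.
by apply: (stieltjes_ge_cst CC.1 T0 psi_continuous) => x xT; apply: cmin;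
  rewrite in_itv.
Qed.

(** Since the equation is solvable, the choice made in the definition is a
solution; its boundedness and measurability follow from the integral
representation. *)
Lemma recursive_utilityP : exists2 K, 0 < K & forall C, consumption_plans T C ->
  [/\ lipschitz_generator T K (fun s u => f s (Y C s) u),
      bounded_measurable `[0, T] (RU C) &
      tail_primitive T (fun s => f s (Y C s) (RU C s)) (RU C)].
Proof.
have [K K0 gen] := aggregator_generator f_aggregator.
exists K => // C CC; have lF := gen _ (Y_bm CC) (Y_ge0 C).
have [U [bU FU]] := tail_solution_exists T0 K0 lF.
have [iF FR] : utility_equation T f (Y C) (RU C).
  apply: (@xgetPex _ (fun=> 0) [set U | utility_equation T f (Y C) U]).
  exists U; split; last by move=> t; rewrite in_itv; exact: FU.
  exact: (bm_integrable (lF.1 _ bU)).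
have FR' : tail_primitive T (fun s => f s (Y C s) (RU C s)) (RU C).
  by move=> t tT; apply: FR; rewrite in_itv.
split => //; apply: eq_bm (tail_integral_bm T0 iF).
by move=> t; rewrite inE/= in_itv/= => /FR'.
Qed.

Lemma utility_bounded : exists B, forall C, budget_set T psi w C -> RU C 0 <= B.
Proof.
have [M M0 CM] := budget_total_bounded.
have [BY hY] := satisfaction_bounded eta_continuous theta_continuous M.
(* The absolute value ensures that the bound also covers u = 0. *)
have [B hB] := aggregator_bounded f_aggregator `|BY|.
have [K K0 ruP] := recursive_utilityP.
exists (2 * (B * T) * expR (2 * K * T)) => C CB.
have [CC _] := CB; have [lF bU FU] := ruP C CC.
have z : tail_primitive T (fun=> 0) (fun=> 0 : R).
  by move=> t _; rewrite Rintegral_cst//= mul0r.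
have := tail_solution_dist T0 K0 lF bU FU (bm_cst _ 0) z (_ : 0 <= 0 <= T).
rewrite lexx T0 => /(_ isT); rewrite subr0 => /(le_trans (ler_norm _)) h.
apply: (le_trans h); rewrite ler_wpM2r ?expR_ge0// ler_wpM2l//.
apply: (le_trans (ler_norm _)); rewrite -[X in _ * X](subr0 T).
apply: Rintegral_itv_bound => //.
  by apply: bm_norm; apply: bmB; [apply: lF.1; exact: bm_cst|exact: bm_cst].
move=> s sT; rewrite normr_id subr0; apply: hB => //.
  rewrite (Y_ge0 C sT)/=; apply: le_trans (ler_norm _) _.
  by apply: le_trans (ler_norm _); apply: hY => //; exact: CM.
by rewrite normr0.
Qed.

Lemma solutionP C : solution T psi f eta theta w C <-> budget_set T psi w C /\
  forall C', budget_set T psi w C' -> RU C' 0 <= RU C 0.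
Proof.
have ub C' : budget_set T psi w C' -> ((RU C' 0)%:E <= value T psi f eta theta w)%E.
  by move=> CB'; apply: ereal_sup_ubound; exists C'.
split=> [[CB CV]|[CB CV]]; split; [exact: CB| |exact: CB|].
  by move=> C' /ub; rewrite -CV lee_fin.
apply/eqP; rewrite eq_le ub//=.
by apply: ge_ereal_sup => _ [C' CB' <-]; rewrite lee_fin; exact: CV.
Qed.

Lemma satisfaction_cvg (Cn : nat -> cumulative R R) C t : 0 <= t <= T ->
  (forall n, consumption_plans T (Cn n)) -> consumption_plans T C ->
  (exists M, forall n, Cn n T <= M) ->
  (forall t, {for t, continuous C} -> Cn n t @[n --> \oo] --> C t) ->
  {for t, continuous C} -> Y (Cn n) t @[n --> \oo] --> Y C t.
Proof.
move=> /[dup] tT /andP[t0 _] CnT CT [M CM] CnC ct; apply: cvgD; first exact: cvg_cst.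
apply: (stieltjes_cvg (G := [set s | {for s, continuous C}]) (M := M)) => //.
- by move=> n s; apply: (CnT n).1.
- exact: CT.1.
- by move=> n; rewrite (le_trans (consumption_plans_le t (CnT n))).
- by move=> a b; exact: cumulative_continuity_dense.
- exact: CnC.
- exact: theta_slice.
Qed.

(** Convergence of the levels of satisfaction at the continuity points of [C],
that is almost everywhere, is convergence of the generators along the limit
utility process. *)
Lemma utility_cvg (Cn : nat -> cumulative R R) C :
  (forall n, consumption_plans T (Cn n)) -> consumption_plans T C ->
  (exists M, forall n, Cn n T <= M) ->
  (forall t, {for t, continuous C} -> Cn n t @[n --> \oo] --> C t) ->
  RU (Cn n) 0 @[n --> \oo] --> RU C 0.
Proof.
move=> CnT CT [M CM] CnC.
have [K K0 ruP] := recursive_utilityP.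
have [BY hY] := satisfaction_bounded eta_continuous theta_continuous M.
have [lF bU FU] := ruP C CT; have [_ [BU hU]] := bU.
have [B hB] := aggregator_bounded f_aggregator (Num.max BY BU).
have UB s : 0 <= s <= T -> `|RU C s| <= BU.
  by move=> sT; apply: hU; rewrite /= in_itv.
apply: (@tail_solution_cvg _ T K (fun s u => f s (Y C s) u) (RU C)
  (fun n s u => f s (Y (Cn n) s) u) (fun n => RU (Cn n)) B T0 K0 _ lF _ _ bU FU).
- by move=> n; have [] := ruP _ (CnT n).
- by move=> n; have [] := ruP _ (CnT n).
- by move=> n; have [] := ruP _ (CnT n).
- move=> n s sT; apply: hB => //.
    rewrite Y_ge0// le_max (le_trans (ler_norm _))//.
    by rewrite (hY _ (CnT n) (CM n) _ sT).
  by rewrite le_max UB// orbT.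
- have lt1 : (-1 : R) < 0 by rewrite ltrN10.
  apply: ae_imply (cumulative_ae_continuous C (-1) (T + 1)) => s h sT.
  have cs : {for s, continuous C}.
    by apply: h; have /andP[s0 sT'] := sT;
      rewrite (lt_le_trans lt1 s0) (le_lt_trans sT')// ltrDl.
  apply: (C1_on_cvg (aggregator_C1 f_aggregator _)); first by rewrite in_itv.
  + exact: Y_ge0.
  + by move=> n; exact: Y_ge0.
  + by apply: satisfaction_cvg => //; exists M.
  + exact: cvg_cst.
Qed.

Lemma solution_exists : exists C, solution T psi f eta theta w C.
Proof.
have [M M0 CM] := budget_total_bounded.
have [BV hBV] := utility_bounded.
pose S := [set RU C 0 | C in budget_set T psi w].
have supS : has_sup S.
  split; last by exists BV => _ [C CB <-]; exact: hBV.
  have [C CE] := @exists_step R 0 0 (lexx 0).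
  exists (RU C 0), C => //; apply/budget_setP; split.
    by apply: (consumption_plans_step _ CE); rewrite lexx.
  by rewrite (stieltjes_step0 CE T0 psi_continuous) mul0r ltW.
have /choice[Cn CnP] : forall n : nat, exists C, budget_set T psi w C /\
    sup S - n.+1%:R^-1 < RU C 0.
  move=> n; have [|_ [C CB <-] h] := @sup_adherent _ S n.+1%:R^-1 _ supS.
    by rewrite invr_gt0.
  by exists C.
have CnT n : consumption_plans T (Cn n) by have [[]] := CnP n.
have CnM n t : 0 <= Cn n t <= M.
  rewrite (cumulative_ge0 (CnT n).1)/= (le_trans (consumption_plans_le t (CnT n)))//.
  by apply: CM; have [] := CnP n.
have [C [phi [phik CphiC]]] := helly_selection CnM.
have CphiT n : consumption_plans T (Cn (phi n)) by [].
have [CT CphiCT] := consumption_plans_closed T0 CphiT CphiC.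
have CphiM n : Cn (phi n) T <= M by have /andP[] := CnM (phi n) T.
exists C; apply/solutionP; split.
  apply/budget_setP; split => //.
  have psic : \int[ls (Cn (phi n))]_(t in `[0, T]) psi t @[n --> \oo] -->
      \int[ls C]_(t in `[0, T]) psi t.
    apply: (stieltjes_cvg (G := [set s | {for s, continuous C}]) (M := M)) => //.
    - by move=> n s; apply: (CphiT n).1.
    - exact: CT.1.
    - by move=> a b; exact: cumulative_continuity_dense.
  rewrite -(cvg_lim (@Rhausdorff R) psic); apply: limr_le.
    by apply/cvg_ex; eexists; exact: psic.
  by apply: nearW => n; have [/budget_setP[]] := CnP (phi n).
move=> C' CB'; apply: (@le_trans _ _ (sup S)).
  by apply: ub_le_sup; [case: supS|exists C'].
have ruc := utility_cvg CphiT CT (ex_intro _ M CphiM) CphiC.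
apply/ler_addgt0Pr => e e0; rewrite -lerBlDr.
rewrite -(cvg_lim (@Rhausdorff R) ruc); apply: limr_ge.
  by apply/cvg_ex; eexists; exact: ruc.
near=> n.
have [_ /ltW h] := CnP (phi n); apply: le_trans h.
rewrite lerD2l lerN2 (@le_trans _ _ n.+1%:R^-1)//.
  by rewrite lef_pV2 ?posrE// ler_nat ltnS.
by apply/ltW; near: n; exact: near_infty_natSinv_lt (PosNum e0).
Unshelve. all: by end_near. Qed.

(** This is how optimality is exploited below: an optimal plan excludes the
first inequality being strict for any competitor [C], and then the second clause
identifies the integrands. *)
Lemma utility_comparison C V g : consumption_plans T C ->
  bounded_measurable `[0, T] g -> tail_primitive T g V ->
  (forall s, 0 <= s <= T -> g s <= f s (Y C s) (V s)) ->
  V 0 <= RU C 0 /\ (RU C 0 <= V 0 ->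
    {ae mu, forall s, 0 <= s <= T -> g s = f s (Y C s) (V s)}).
Proof.
move=> CT bg gV gF; have [K K0 ruP] := recursive_utilityP.
have [lF bU FU] := ruP C CT; split.
  by apply: (tail_comparison T0 K0 lF bU FU bg gV gF); rewrite lexx T0.
exact: (tail_comparison_eq T0 K0 lF bU FU bg gV gF).
Qed.

Lemma dist_le_of_close_to_common (x x' u u' e A B A' B' : R) :
  `|u - x| <= e * A + B * e -> `|u' - x'| <= e * A' + B' * e -> u = u' ->
  `|x - x'| <= e * (A + B + (A' + B')).
Proof.
move=> h h' E.
have -> : e * (A + B + (A' + B')) = e * A + B * e + (e * A' + B' * e) by ring.
rewrite -(subrKA u) (le_trans (ler_normD _ _))// lerD//; first by rewrite distrC.
by rewrite E.
Qed.

(** Intervals arbitrarily close to [t] on which both plans are almost constant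
contain times where the levels of satisfaction agree; the integral parts at such
times are close to those at [t]. The function [eta] is subtracted, as only the
integral parts obey [satisfaction_increment]. *)
Lemma satisfaction_eq_of_ae C C' t : consumption_plans T C ->
  consumption_plans T C' ->
  {ae mu, forall s, 0 <= s <= T -> Y C s = Y C' s} -> 0 <= t <= T ->
  (forall e, 0 < e -> exists a b, a < b /\ forall s, a < s < b ->
    [/\ 0 <= s <= T, `|s - t| < e, `|C s - C t| <= e & `|C' s - C' t| <= e]) ->
  Y C t = Y C' t.
Proof.
move=> CT CT' aeY tT near_t.
have [B B0 hB] := satisfaction_increment eta theta_continuous CT.
have [B' B'0 hB'] := satisfaction_increment eta theta_continuous CT'.
have CT0 := cumulative_ge0 CT.1 T; have CT'0 := cumulative_ge0 CT'.1 T.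
suff E : Y C t - eta t = Y C' t - eta t by exact: (addIr _ E).
apply: (@eq_of_dist_le _ _ _ ((C T + B) + (C' T + B'))) => [|e e0].
  exact: (addr_ge0 (addr_ge0 CT0 B0) (addr_ge0 CT'0 B'0)).
have [d d0 dP] := hB e e0; have [d' d'0 dP'] := hB' e e0.
have [r [r0 re rd rd']] : exists r, [/\ 0 < r, r <= e, r <= d & r <= d'].
  exists (Num.min e (Num.min d d')); split; rewrite ?lt_min ?e0 ?d0 ?d'0//.
  - by rewrite ge_min lexx.
  - by rewrite !ge_min lexx orbT.
  - by rewrite !ge_min lexx !orbT.
have [a [b [ab abP]]] := near_t r r0.
have [s Ys /abP[sT st Cst C'st]] := ae_itv_exists aeY ab.
have h := dP t s tT sT (lt_le_trans st rd).
have h' := dP' t s tT sT (lt_le_trans st rd').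
have hh := le_trans h (lerD (lexx _) (ler_wpM2l B0 (le_trans Cst re))).
have hh' := le_trans h' (lerD (lexx _) (ler_wpM2l B'0 (le_trans C'st re))).
have Es : Y C s - eta s = Y C' s - eta s := congr1 (fun y => y - eta s) (Ys sT).
exact: (dist_le_of_close_to_common hh hh' Es).
Qed.

Lemma le_half_sum (x y z : R) : x = y -> z <= x ->
  z <= 2^-1 * x + (1 - 2^-1) * y.
Proof. by move=> ->; lra. Qed.

Lemma strictly_concave_eq (h : R -> R -> R) a y y' u u' :
  strictly_concave_on (@half_plane R) h -> 0 < a < 1 -> 0 <= y -> 0 <= y' ->
  a * h y u + (1 - a) * h y' u' = h (a * y + (1 - a) * y') (a * u + (1 - a) * u') ->
  y = y'.
Proof.
move=> hh a01 y0 y'0 E; apply: contrapT => ne.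
have := hh (y, u) (y', u') a y0 y'0 _ a01.
by rewrite /= E ltxx => /(_ _)/wrap[] // -[].
Qed.

Lemma strictly_concave_le (h : R -> R -> R) a y y' u u' :
  strictly_concave_on (@half_plane R) h -> 0 < a < 1 -> 0 <= y -> 0 <= y' ->
  a * h y u + (1 - a) * h y' u' <= h (a * y + (1 - a) * y') (a * u + (1 - a) * u').
Proof.
move=> hh a01 y0 y'0; have [[-> ->]|/eqP ne] := eqVneq (y, u) (y', u').
  by rewrite -!mulrDl [a + _]addrC subrK !mul1r.
exact/ltW/(hh (y, u) (y', u') a y0 y'0 ne a01).
Qed.

Lemma half_sum_le (x y z : R) : x <= z -> y <= z ->
  2^-1 * x + (1 - 2^-1) * y <= z.
Proof. by lra. Qed.

(** The average of the two utility processes is driven by the average of the two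
integrands, which concavity of [f] puts below the integrand of the average plan.
As both plans are optimal, that plan cannot do better at time 0, so the
comparison is an equality almost everywhere; there strict concavity leaves no
room for different levels of satisfaction. *)
Lemma solutions_ae_eq C C' : solution T psi f eta theta w C ->
  solution T psi f eta theta w C' ->
  {ae mu, forall s, 0 <= s <= T -> Y C s = Y C' s}.
Proof.
move=> /solutionP[CB Cmax] /solutionP[CB' Cmax'].
have [/budget_setP[CT Cw] /budget_setP[CT' Cw']] := (CB, CB').
have h0 : 0 < 2^-1 :> R by rewrite invr_gt0.
have h1 : 0 < (2^-1 : R) < 1 by rewrite h0 invf_lt1// ltr1n.
have h1' : 1 - 2^-1 = 2^-1 :> R by field.
have [C3 C3E] : exists C3, forall s, C3 s = 2^-1 * C s + (1 - 2^-1) * C' s.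
  apply: exists_cumulative_lincomb => x y xy; rewrite h1'.
  by rewrite lerD// ler_pM2l// cumulative_is_nondecreasing.
have CT3 : consumption_plans T C3.
  split => t ht; first by rewrite C3E CT.1// CT'.1// !mulr0 addr0.
  by rewrite (C3E t) (C3E T) CT.2// CT'.2.
have CB3 : budget_set T psi w C3.
  apply/budget_setP; split; first by [].
  rewrite (stieltjes_linear CT.1 CT'.1 CT3.1 (fun s _ => C3E s) T0 psi_continuous).
  exact (half_sum_le Cw Cw').
have [K K0 ruP] := recursive_utilityP.
have [lF bU FU] := ruP C CT; have [lF' bU' FU'] := ruP C' CT'.
pose V s := 2^-1 * RU C s + (1 - 2^-1) * RU C' s.
pose g s := 2^-1 * f s (Y C s) (RU C s) + (1 - 2^-1) * f s (Y C' s) (RU C' s).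
have bF := bmZ 2^-1 (lF.1 _ bU); have bF' := bmZ (1 - 2^-1) (lF'.1 _ bU').
have bg : bounded_measurable `[0, T] g := bmD bF bF'.
have gV : tail_primitive T g V :=
  tail_primitive_lincomb _ _ (lF.1 _ bU) (lF'.1 _ bU') FU FU'.
have Y3 s : 0 <= s <= T -> Y C3 s = 2^-1 * Y C s + (1 - 2^-1) * Y C' s.
  exact: (satisfaction_convex eta theta_continuous CT CT' CT3 C3E).
have concave s (sT : 0 <= s <= T) : strictly_concave_on (@half_plane R) (f s).
  by apply: (aggregator_strictly_concave f_aggregator); rewrite in_itv.
have gF s : 0 <= s <= T -> g s <= f s (Y C3 s) (V s).
  move=> sT; rewrite (Y3 s sT).
  exact (strictly_concave_le _ _ (concave s sT) h1 (Y_ge0 C sT) (Y_ge0 C' sT)).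
have UU' : RU C 0 = RU C' 0.
  by apply/eqP; rewrite eq_le; apply/andP; split;
    [exact: Cmax' _ CB|exact: Cmax _ CB'].
have aeg := (utility_comparison CT3 bg gV gF).2 (le_half_sum UU' (Cmax _ CB3)).
move: aeg; apply: ae_imply => s gs sT; have := gs sT; rewrite (Y3 s sT) => gE.
exact (strictly_concave_eq (concave s sT) h1 (Y_ge0 C sT) (Y_ge0 C' sT) gE).
Qed.

(** If [theta] vanishes against mass at time 0, then a unit mass at 0 is not
distinguished from the zero plan. Continuity upgrades vanishing almost
everywhere to vanishing everywhere. *)
Lemma injective_theta0 : satisfaction_injective T eta theta ->
  ~ {ae mu, forall s, 0 <= s <= T -> theta s 0 = 0}.
Proof.
move=> inj ae0.
have th0 t : 0 <= t <= T -> theta t 0 = 0.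
  move=> tT; apply: (@eq_of_dist_le _ _ _ 1) => // e e0; rewrite mulr1.
  have [d d0 dP] := theta_unif_continuous theta_continuous e0.
  have /andP[t0 tT'] := tT.
  have ab : Num.max 0 (t - d) < Num.min T (t + d).
    by rewrite gt_max !lt_min T_gt0/=; apply/and3P; split; lra.
  have [s s0 /andP[]] := ae_itv_exists ae0 ab.
  rewrite gt_max lt_min => /andP[s1 s2] /andP[s3 s4].
  have sT : 0 <= s <= T by rewrite !ltW.
  have := dP t s 0 0 tT sT; rewrite lexx T0 subrr normr0 (s0 sT) => h.
  by apply/ltW/h => //; rewrite ltr_norml; apply/andP; split; lra.
have [C1 C1E] := @exists_step R 0 1 ler01; have [C0 C0E] :=
  @exists_step R 0 0 (lexx 0).
have T00 : 0 <= (0 : R) <= T by rewrite lexx.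
have E0 : (0 : R) \in `[0, T] by rewrite in_itv/= T00.
have := inj C1 C0 (consumption_plans_step T00 C1E) (consumption_plans_step T00 C0E) _ 0 E0.
rewrite (C1E 0) (C0E 0) ltxx => /(_ _)/wrap[]; last by move=> /eqP; rewrite oner_eq0.
move=> t; rewrite in_itv/= => /[dup] tT /andP[t0 _].
rewrite /satisfaction (stieltjes_step0 C1E t0 (theta_slice tT)).
by rewrite (stieltjes_step0 C0E t0 (theta_slice tT)) th0// mulr0 mul0r.
Qed.

(** Otherwise [C] jumps at [T] by at least some [c]. Removing [c] from the jump
leaves the utility unchanged, and saves [c * psi T], which buys the mass [c *
psi T / psi 0] at time 0. By optimality this does not increase the utility, so
by strict monotonicity of [f] the kernel [theta s 0] vanishes almost everywhere.
*)
Lemma solution_no_end_mass C : satisfaction_injective T eta theta ->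
  solution T psi f eta theta w C ->
  forall e, 0 < e -> exists2 t, 0 <= t < T & C T - C t <= e.
Proof.
move=> inj /solutionP[CB Cmax] c c0; apply: contrapT => noT.
have [CT Cw] := (budget_setP C).1 CB.
have jump t : t < T -> C t <= C T - c.
  move=> tT; rewrite lerBrDr -lerBrDl leNgt; apply/negP => h.
  apply: noT; exists (Num.max 0 t); first by rewrite le_max lexx gt_max T_gt0.
  rewrite lerBlDr (le_trans _ (_ : c + C t <= _)) ?lerD2l//; last first.
    by apply: cumulative_is_nondecreasing; rewrite le_max lexx orbT.
  by move: h; lra.
apply: (injective_theta0 inj).
have TT : 0 <= T <= T by rewrite lexx T0.
have T00 : 0 <= (0 : R) <= T by rewrite lexx.
have [E EE] := @exists_step R T 1 ler01.
have ET := consumption_plans_step TT EE.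
(* E is a unit mass at T, S a unit mass at 0; C1 = C - c E and C2 = C1 + b S. *)
have [S SE] := @exists_step R 0 1 ler01.
have ST := consumption_plans_step T00 SE.
have [C1 C1E] : exists C1, forall s, C1 s = 1 * C s + (- c) * E s.
  apply: exists_cumulative_lincomb => x y xy; rewrite !mul1r.
  rewrite (EE x) (EE y); have [xT|Tx] := ltP x T.
    rewrite mulr0 addr0; case: ifPn => [_|]; first
      by rewrite mulr0 addr0 cumulative_is_nondecreasing.
    rewrite -leNgt => Ty; rewrite mulr1 (le_trans (jump x xT))// lerD2r.
    exact: cumulative_is_nondecreasing.
  by rewrite ltNge (le_trans Tx xy)/= lerD2r cumulative_is_nondecreasing.
have CT1 : consumption_plans T C1.
  split => t ht; first by rewrite C1E CT.1// ET.1// !mulr0 addr0.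
  by rewrite (C1E t) (C1E T) CT.2// ET.2.
have psi0 : 0 < psi 0 by apply: psi_gt0; rewrite in_itv/= lexx.
have psiT : 0 < psi T by apply: psi_gt0; rewrite in_itv/= lexx T0.
pose b := c * psi T / psi 0; have b0 : 0 < b by rewrite divr_gt0// mulr_gt0.
have [C2 C2E] : exists C2, forall s, C2 s = 1 * C1 s + b * S s.
  apply: exists_cumulative_lincomb => x y xy; rewrite !mul1r.
  by rewrite lerD ?ler_wpM2l ?cumulative_is_nondecreasing// ltW.
have CT2 : consumption_plans T C2.
  split => t ht; first by rewrite C2E CT1.1// ST.1// !mulr0 addr0.
  by rewrite (C2E t) (C2E T) CT1.2// ST.2.
have CB2 : budget_set T psi w C2.
  apply/budget_setP; split; first by [].
  rewrite (stieltjes_linear CT1.1 ST.1 CT2.1 (fun s _ => C2E s) T0 psi_continuous).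
  rewrite (stieltjes_linear CT.1 ET.1 CT1.1 (fun s _ => C1E s) T0 psi_continuous).
  rewrite (stieltjes_step0 SE T0 psi_continuous) (stieltjes_step_end EE T0 psi_continuous).
  by rewrite !mul1r /b divfK ?gt_eqF// mulNr addrNK.
have Y2 t : 0 <= t <= T -> Y C2 t = Y C1 t + b * theta t 0.
  move=> /[dup] tT /andP[t0 _]; rewrite /satisfaction.
  rewrite (stieltjes_linear CT1.1 ST.1 CT2.1 (fun s _ => C2E s) t0 (theta_slice tT)).
  by rewrite (stieltjes_step0 SE t0 (theta_slice tT)) !mul1r addrA.
have Y1 t : 0 <= t < T -> Y C1 t = Y C t.
  move=> /andP[t0 tT]; have tT' : 0 <= t <= T by rewrite t0 ltW.
  rewrite /satisfaction; apply: (congr1 (+%R (eta t))).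
  rewrite (stieltjes_linear (a := 1) (b := 0) CT.1 ET.1 CT1.1 _ t0 (theta_slice tT')).
    by rewrite mul1r mul0r addr0.
  move=> s /andP[_ st]; rewrite C1E (EE s) (le_lt_trans st tT).
  by rewrite !mulr0.
have [K K0 ruP] := recursive_utilityP.
have [lF bU FU] := ruP C CT; have [lF1 _ _] := ruP C1 CT1.
pose U := RU C; pose g s := f s (Y C1 s) (U s).
have bg : bounded_measurable `[0, T] g by exact: lF1.1.
have gU : tail_primitive T g U.
  have gE s : 0 <= s < T -> f s (Y C s) (U s) = g s by move=> sT;
    rewrite /g (Y1 s sT).
  exact (tail_primitive_eq_end (lF.1 _ bU) bg gE FU).
have incr s : 0 <= s <= T -> 0 < theta s 0 -> g s < f s (Y C2 s) (U s).
  move=> sT th; apply: (aggregator_increasing f_aggregator).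
  - by rewrite in_itv.
  - by rewrite in_itv/= andbT Y_ge0.
  - by rewrite in_itv/= andbT Y_ge0.
  - by rewrite Y2// ltrDl mulr_gt0.
have theta0_ge0 s : 0 <= s <= T -> 0 <= theta s 0.
  by move=> sT; apply: theta_ge0; rewrite in_itv/= ?lexx.
have gF s : 0 <= s <= T -> g s <= f s (Y C2 s) (U s).
  move=> sT; have := theta0_ge0 s sT; rewrite le_eqVlt => /predU1P[E0|th].
    by rewrite Y2// -E0 mulr0 addr0.
  by apply/ltW/incr.
have [_ /(_ (Cmax _ CB2))] := utility_comparison CT2 bg gU gF.
apply: ae_imply => s gs sT; apply/eqP; move: (theta0_ge0 s sT).
rewrite le_eqVlt eq_sym => /predU1P[->//|/(incr s sT)].
by rewrite (gs sT) ltxx.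
Qed.

(** Near [t < T] both plans are almost constant to the right of [t]; near [T]
they are almost constant to the left, as they have no mass at [T]. *)
Lemma solution_unique : satisfaction_injective T eta theta ->
  forall C C', solution T psi f eta theta w C -> solution T psi f eta theta w C' ->
  {in `[0, T], C =1 C'}.
Proof.
move=> inj C C' sC sC'.
have [/solutionP[/budget_setP[CT _] _] /solutionP[/budget_setP[CT' _] _]] :=
  (sC, sC').
have aeY := solutions_ae_eq sC sC'.
have ndC := cumulative_is_nondecreasing C; have ndC' :=
  cumulative_is_nondecreasing C'.
apply: (inj C C' CT CT') => t; rewrite in_itv/= => /[dup] tT /andP[t0 tT'].
apply: satisfaction_eq_of_ae => // e e0.
move: tT'; rewrite le_eqVlt => /predU1P[tE|tT'].
  have [s /andP[s0 sT] hs] := solution_no_end_mass inj sC e0.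
  have [s' /andP[s'0 s'T] hs'] := solution_no_end_mass inj sC' e0.
  exists (Num.max (Num.max s s') (T - e)), T; split.
    by rewrite !gt_max sT s'T gtrBl.
  move=> r /andP[]; rewrite !gt_max tE => /andP[/andP[sr s'r] er] rT.
  have CrT : C r <= C T by apply/ndC/ltW.
  have C'rT : C' r <= C' T by apply/ndC'/ltW.
  split.
  - by rewrite (le_trans s0 (ltW sr)) ltW.
  - by rewrite distrC gtr0_norm ?subr_gt0//; lra.
  - rewrite distrC ger0_norm ?subr_ge0//; apply: le_trans hs.
    by rewrite lerD2l lerN2; apply/ndC/ltW.
  - rewrite distrC ger0_norm ?subr_ge0//; apply: le_trans hs'.
    by rewrite lerD2l lerN2; apply/ndC'/ltW.
have [d d0 hd] := cumulative_right_lt C t e0.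
have [d' d'0 hd'] := cumulative_right_lt C' t e0.
exists t, (Num.min (Num.min T (t + e)) (Num.min (t + d) (t + d'))); split.
  by rewrite !lt_min tT' !ltrDl e0 d0.
move=> r /andP[tr]; rewrite !lt_min => /andP[/andP[rT re] /andP[rd rd']].
have Ctr : C t <= C r by apply/ndC/ltW.
have C'tr : C' t <= C' r by apply/ndC'/ltW.
split.
- by rewrite (le_trans t0 (ltW tr)) ltW.
- by rewrite gtr0_norm ?subr_gt0//; lra.
- rewrite ger0_norm ?subr_ge0// lerBlDl; apply: le_trans hd.
  by apply/ndC/ltW.
- rewrite ger0_norm ?subr_ge0// lerBlDl; apply: le_trans hd'.
  by apply/ndC'/ltW.
Qed.

End Problem.

(** * Existence and uniqueness of the optimal plan *)

Theorem theorem2p3 (R : realType) (T w : R) (psi : R -> R)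
    (eta : R -> R) (theta : R -> R -> R) (f : R -> R -> R -> R)
    (T_gt0 : 0 < T) (w_gt0 : 0 < w)
    (psi_continuous : {within `[0, T], continuous psi})
    (psi_gt0 : forall t, t \in `[0, T] -> 0 < psi t)
    (eta_continuous : {within `[0, T], continuous eta})
    (eta_ge0 : forall t, t \in `[0, T] -> 0 <= eta t)
    (theta_continuous : {within `[0, T] `*` `[0, T],
                           continuous (fun p : R * R => theta p.1 p.2)})
    (theta_ge0 : forall t s, t \in `[0, T] -> s \in `[0, T] -> 0 <= theta t s)
    (f_aggregator : aggregator T f) :
  (exists C : cumulative R R, solution T psi f eta theta w C) /\
  (satisfaction_injective T eta theta ->
   forall C C' : cumulative R R,
     solution T psi f eta theta w C -> solution T psi f eta theta w C' ->
     {in `[0, T], C =1 C'}).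
Proof.
split; first exact: solution_exists.
move=> inj C C'; exact: solution_unique.
Qed.
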